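(* Let $d$ be an odd positive integer, let $k$ be a field, let $A$ be a basic finite dimensional $k$-algebra that is twisted $(d+2)$-periodic with respect to an algebra automorphism $\sigma$ of $A$, and endow $\operatorname{proj}A$ with the Amiot--Lin $(d+2)$-angulated category structure. Then every integral rank function on morphisms in $\operatorname{proj}A$ can be decomposed uniquely as a locally finite sum of irreducible rank functions on morphisms in $\operatorname{proj}A$.
   Context: Amiot--Lin structure. $\operatorname{mod}A$ is the category of finite dimensional right $A$-modules and $\operatorname{proj}A$ its full subcategory of projective modules. For an algebra automorphism $\tau$ of $A$, ${}_{\tau}A_1$ is the $A$-bimodule with underlying space $A$, left action $a\cdot x=\tau(a)x$ and right action $x\cdot b=xb$. $A$ is twisted $(d+2)$-periodic with respect to $\sigma$ if the $(d+2)$-th syzygy of $A$ as an $A$-bimodule is isomorphic to ${}_{\sigma^{-1}}A_1$. Then $A$ is selfinjective and there is an exact sequence of finite dimensional $A$-bimodules $\theta\colon 0\to{}_{\sigma^{-1}}A_1\to P_{d+1}\to\cdots\to P_1\to P_0\to A\to0$ with each $P_i$ projective-injective; fix it. The functors $\Sigma_d=-\otimes_A{}_\sigma A_1$ and $\Sigma_d^{-1}=-\otimes_A{}_{\sigma^{-1}}A_1$ are exact, mutually quasi-inverse on $\operatorname{mod}A$, and restrict to $\operatorname{proj}A$. A sequence $X_0\xrightarrow{x_0}X_1\xrightarrow{x_1}\cdots\to X_{d+1}\xrightarrow{x_{d+1}}\Sigma_dX_0$ in $\operatorname{proj}A$ is a $(d+2)$-angle if: (C1) $X_0\xrightarrow{x_0}X_1\to\cdots\to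 X_{d+1}\xrightarrow{x_{d+1}}\Sigma_dX_0\xrightarrow{\Sigma_dx_0}\Sigma_dX_1$ is exact in $\operatorname{mod}A$; (C2) writing $p\colon\Sigma_dX_0\to C$ for the cokernel of $x_{d+1}$, there is $i\colon\Sigma_d^{-1}C\to X_1$ such that $x_0$ is the composition $X_0\cong\Sigma_d^{-1}\Sigma_dX_0\xrightarrow{\Sigma_d^{-1}p}\Sigma_d^{-1}C\xrightarrow{i}X_1$ and $0\to\Sigma_d^{-1}C\xrightarrow{i}X_1\xrightarrow{x_1}\cdots\to X_{d+1}\xrightarrow{x_{d+1}}\Sigma_dX_0\xrightarrow{p}C\to0$ is exact, and this exact sequence is equivalent in $\operatorname{Ext}_A^{d+2}(C,\Sigma_d^{-1}C)$ to the (exact) sequence $C\otimes_A\theta$. It is known (Amiot, Lin) that with these $(d+2)$-angles $(\operatorname{proj}A,\Sigma_d)$ is a $(d+2)$-angulated category in the sense of Geiss--Keller--Oppermann. Rank functions. A rank function on morphisms $\rho_{\mathrm m}$ in $\operatorname{proj}A$ assigns to each morphism $f$ a nonnegative real number such that: (RM0) $\rho_{\mathrm m}(f)=\rho_{\mathrm m}(g)$ whenever there are isomorphisms $\psi,\varphi$ with $\varphi f=g\psi$; (RM1) $\rho_{\mathrm m}(f\oplus g)=\rho_{\mathrm m}(f)+\rho_{\mathrm m}(g)$; (RM2) $\rho_{\mathrm m}(f)-\rho_{\mathrm m}(1_Y)+\rho_{\mathrm m}(g)=0$ for each pair of consecutive morphisms $X\xrightarrow{f}Y\xrightarrow{g}Z$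 in a $(d+2)$-angle; (RM3) $\rho_{\mathrm m}(\Sigma_df)=\rho_{\mathrm m}(f)$. It is integral if it has integer values. Sums are pointwise. It is irreducible if it is nonzero, integral and whenever $\rho_{\mathrm m}=\rho_{\mathrm m,1}+\rho_{\mathrm m,2}$ with integral rank functions on morphisms, then $\rho_{\mathrm m,1}=0$ or $\rho_{\mathrm m,2}=0$. A family $\{\rho_{\mathrm m,i}\}_{i\in I}$ of rank functions, indexed by a set $I$ (repetitions allowed), has a locally finite sum $\sum_{i\in I}\rho_{\mathrm m,i}$, defined pointwise, if for every morphism $f$ the set $\{i\in I\mid\rho_{\mathrm m,i}(f)\neq0\}$ is finite. Uniqueness is up to reindexing of the family of summands. *)

(* Defs.v *)
From HB Require Import structures.
From mathcomp Require Import all_boot all_order all_algebra all_field.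
From mathcomp Require Import all_classical all_reals.
From Stdlib Require Import Relation_Operators.

Set Implicit Arguments.
Unset Strict Implicit.
Unset Printing Implicit Defensive.

Import Order.TTheory GRing.Theory Num.Theory.
Import VectorInternalTheory.
Local Open Scope ring_scope.

Section LinearAlgebra.
Variable k : fieldType.
Implicit Types V W N : vectType k.

Lemma linfunE V W (f : V -> W) : linear f -> linfun f =1 f.
Proof.
move=> fL; pose ff : {linear V -> W} :=
  HB.pack f (GRing.isLinear.Build k V W *:%R f fL).
exact: (lfunE ff).
Qed.

(** The quotient V / U is realised on the chosen complement [U^C] of U;
    [qpi U] is the projection onto it, with kernel U, and [qsec U] is a section
    of [qpi U]. *)
Definition quo V (U : {vspace V}) : vectType k := subvs_of (U^C)%VS.
Definition qpi V (U : {vspace V}) : 'Hom(V, quo U) :=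
  (linfun (vsproj U^C) \o daddv_pi U^C U)%VF.
Definition qsec V (U : {vspace V}) : 'Hom(quo U, V) := linfun vsval.
Definition qmap V W (U : {vspace V}) (U' : {vspace W}) (f : 'Hom(V, W)) :
  'Hom(quo U, quo U') := (qpi U' \o f \o qsec U)%VF.

Lemma capCv V (U : {vspace V}) : (U^C :&: U = 0)%VS.
Proof. by rewrite capvC capv_compl. Qed.

Lemma qpiK V (U : {vspace V}) x : qpi U (qsec U x) = x.
Proof.
rewrite /qpi comp_lfunE /= !lfunE /= daddv_pi_id ?capCv ?subvsP //.
exact: vsvalK.
Qed.

Lemma qsecK V (U : {vspace V}) v : v - qsec U (qpi U v) \in U.
Proof.
rewrite /qpi comp_lfunE /= !lfunE /= vsprojK ?memv_pi //.
have vUC : v \in (U^C + U)%VS by rewrite addvC addv_complf memvf.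
by rewrite -{1}(daddv_pi_add (capCv U) vUC) addrC addKr memv_pi.
Qed.

Lemma qpi_eq0 V (U : {vspace V}) v : (qpi U v == 0) = (v \in U).
Proof.
apply/idP/idP => [/eqP v0|vU]; first by have := qsecK U v; rewrite v0 linear0 subr0.
have sU : qsec U (qpi U v) \in U by rewrite -(subKr v (qsec U _)) memvB ?qsecK.
have: qsec U (qpi U v) \in (U^C :&: U)%VS.
  by rewrite memv_cap sU andbT lfunE subvsP.
by rewrite capCv memv0 => /eqP s0; rewrite -[qpi U v]qpiK s0 linear0.
Qed.

Lemma qmapE V W (U : {vspace V}) (U' : {vspace W}) (f : 'Hom(V, W)) v :
  (f @: U <= U')%VS -> qmap U U' f (qpi U v) = qpi U' (f v).
Proof.
move=> /subvP fU; rewrite /qmap 2!comp_lfunE; apply/esym/eqP.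
rewrite -subr_eq0 -linearB qpi_eq0 -linearB.
by apply: fU; apply: memv_img; apply: qsecK.
Qed.

(** V (x)_k W is realised by matrices of coordinates: v (x) w is the matrix
    (v_i w_j). *)
Definition ktens V W : vectType k := 'M[k]_(dim V, dim W).
Definition kpure V W (v : V) (w : W) : ktens V W := (v2r v)^T *m v2r w.
Definition ktmap V V' W W' (f : 'Hom(V, V')) (g : 'Hom(W, W')) :
    'Hom(ktens V W, ktens V' W') :=
  linfun (fun X : 'M[k]_(dim V, dim W) => (f2mx f)^T *m X *m f2mx g).
Definition ktlift V W N (b : V -> W -> N) : 'Hom(ktens V W, N) :=
  linfun (fun X : 'M[k]_(dim V, dim W) =>
    \sum_i \sum_j X i j *: b (r2v (delta_mx 0 i)) (r2v (delta_mx 0 j))).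

Lemma kpureDl V W (w : W) : linear (fun v : V => kpure v w).
Proof. by move=> a u v; rewrite /kpure !linearP /= mulmxDl -scalemxAl. Qed.

Lemma kpureDr V W (v : V) : linear (fun w : W => kpure v w).
Proof. by move=> a u w; rewrite /kpure linearP /= mulmxDr -scalemxAr. Qed.

Lemma ktmapE V V' W W' (f : 'Hom(V, V')) (g : 'Hom(W, W')) v w :
  ktmap f g (kpure v w) = kpure (f v) (g w).
Proof.
rewrite /ktmap linfunE; last first.
  by move=> a X Y; rewrite mulmxDr mulmxDl -scalemxAr -scalemxAl.
have v2r_fE U U' (h : 'Hom(U, U')) u : v2r (h u) = v2r u *m f2mx h.
  by rewrite unlock /= r2vK.
by rewrite /kpure !v2r_fE trmx_mul !mulmxA.
Qed.

Lemma kt_ext V W N (f g : 'Hom(ktens V W, N)) :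
  (forall v w, f (kpure v w) = g (kpure v w)) -> f = g.
Proof.
move=> fg; apply/lfunP => X; rewrite (matrix_sum_delta X).
rewrite !linear_sum; apply: eq_bigr => i _; rewrite !linear_sum.
apply: eq_bigr => j _; rewrite !linearZ; congr (_ *: _).
have -> : delta_mx i j = kpure (r2v (delta_mx 0 i)) (r2v (delta_mx 0 j)) :> ktens V W.
  by rewrite /kpure !r2vK trmx_delta mul_delta_mx.
exact: fg.
Qed.

Lemma lfun_coord V N (f : 'Hom(V, N)) v :
  f v = \sum_i v2r v 0 i *: f (r2v (delta_mx 0 i)).
Proof.
rewrite -{1}[v]v2rK {1}(row_sum_delta (v2r v)) !linear_sum.
by apply: eq_bigr => i _; rewrite !linearZ.
Qed.

Lemma ktliftE V W N (b : V -> W -> N) v w :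
  (forall w, linear (b^~ w)) -> (forall v, linear (b v)) ->
  ktlift b (kpure v w) = b v w.
Proof.
move=> bl br; rewrite /ktlift linfunE; last first.
  move=> a X Y; rewrite scaler_sumr -big_split; apply: eq_bigr => i _ /=.
  rewrite scaler_sumr -big_split; apply: eq_bigr => j _ /=.
  by rewrite !mxE scalerDl scalerA.
have -> : b v w = linfun (b^~ w) v by rewrite (linfunE (bl w)).
rewrite lfun_coord; apply: eq_bigr => i _; rewrite (linfunE (bl w)).
have -> : b (r2v (delta_mx 0 i)) w = linfun (b (r2v (delta_mx 0 i))) w.
  by rewrite (linfunE (br _)).
rewrite lfun_coord scaler_sumr; apply: eq_bigr => j _.
by rewrite (linfunE (br _)) scalerA /kpure mxE big_ord1 !mxE.
Qed.

End LinearAlgebra.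

Section Modules.
Variables (k : fieldType) (A : falgType k).

(** Finite dimensional right A-modules: [ract M a x] is x.a *)
Record rmod := RMod {
  rcar :> vectType k;
  ract : 'Hom(A, 'End(rcar));
  ract1 : ract 1 = \1%VF;
  ractM : forall a b, ract (a * b) = (ract b \o ract a)%VF }.

Record rhom (M N : rmod) := RHom {
  rfun :> 'Hom(M, N);
  rhomP : forall a x, rfun (ract M a x) = ract N a (rfun x) }.

(** Finite dimensional A-bimodules (with k acting centrally): [lact B a x] is
    a.x *)
Record bimod := BiMod {
  bright :> rmod;
  lact : 'Hom(A, 'End(bright));
  lact1 : lact 1 = \1%VF;
  lactM : forall a b, lact (a * b) = (lact a \o lact b)%VF;
  lractC : forall a b, (lact a \o ract bright b = ract bright b \o lact a)%VF }.

Record bhom (B C : bimod) := BHom {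
  bfun :> rhom B C;
  bhomP : forall a x, bfun (lact B a x) = lact C a (bfun x) }.

Definition injl (V W : vectType k) (f : 'Hom(V, W)) := lker f == 0%VS.
Definition surjl (V W : vectType k) (f : 'Hom(V, W)) := limg f == fullv.
Definition exact_at (V W U : vectType k) (f : 'Hom(V, W)) (g : 'Hom(W, U)) :=
  limg f == lker g.

Definition rid (M : rmod) : rhom M M.
Proof. by exists \1%VF => a x; rewrite !id_lfunE. Defined.

Definition rcomp (L M N : rmod) (g : rhom M N) (f : rhom L M) : rhom L N.
Proof. by exists (g \o f)%VF => a x; rewrite !comp_lfunE !rhomP. Defined.

Definition is_riso (M N : rmod) (f : rhom M N) : Prop :=
  exists g : rhom N M, (g \o f = \1)%VF /\ (f \o g = \1)%VF.
Definition risom (M N : rmod) : Prop := exists f : rhom M N, is_riso f.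

Definition bisom (B C : bimod) : Prop :=
  exists (f : bhom B C) (g : bhom C B), (g \o f = \1)%VF /\ (f \o g = \1)%VF.

(** Projectivity and injectivity are relative to the finite dimensional modules
    and bimodules; over a finite dimensional algebra this is the usual notion. *)
Definition rprojective (P : rmod) : Prop :=
  forall (M N : rmod) (g : rhom M N) (f : rhom P N), surjl g ->
  exists h : rhom P M, (g \o h)%VF = f.

Definition bprojective (P : bimod) : Prop :=
  forall (M N : bimod) (g : bhom M N) (f : bhom P N), surjl g ->
  exists h : bhom P M, (g \o h)%VF = f.

Definition binjective (Q : bimod) : Prop :=
  forall (M N : bimod) (g : bhom M N) (f : bhom M Q), injl g ->
  exists h : bhom N Q, (h \o g)%VF = f.

Record algaut := AlgAut { aut :> 'AEnd(A); aut_inj : lker aut == 0%VS }.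

Lemma aut_inv_ahom (s : algaut) : ahom_in {:A} (s^-1)%VF.
Proof.
have sK := lker0_lfunK (aut_inj s); have sVK := lker0_lfunVK (aut_inj s).
apply/ahomP_tmp; split=> [|x y].
  by rewrite -{1}(rmorph1 s) sK.
by rewrite -{1}(sVK x) -{1}(sVK y) -rmorphM sK.
Qed.

Lemma aut_inv_inj (s : algaut) : lker (s^-1)%VF == 0%VS.
Proof.
apply/lker0P => x y e.
by rewrite -(lker0_lfunVK (aut_inj s) x) e lker0_lfunVK ?aut_inj.
Qed.

Definition aut_inv (s : algaut) : algaut :=
  @AlgAut (AHom (aut_inv_ahom s)) (aut_inv_inj s).

Lemma amulr_act : linfun (@amulr k A) 1 = \1%VF /\
  forall a b, linfun (@amulr k A) (a * b)
              = (linfun (@amulr k A) b \o linfun (@amulr k A) a)%VF.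
Proof.
split=> [|a b]; apply/lfunP => x; rewrite !lfunE /=; first by rewrite mulr1.
by rewrite !lfunE /= mulrA.
Qed.

Definition rreg : rmod := RMod amulr_act.1 amulr_act.2.

Definition twist_lact (t : 'AEnd(A)) : 'Hom(A, 'End(A)) :=
  (linfun (@amull k A) \o t)%VF.

Lemma twist_lactE t a x : twist_lact t a x = t a * x.
Proof. by rewrite !lfunE /= !lfunE. Qed.

Lemma twist_lact1 t : twist_lact t 1 = \1%VF.
Proof. by apply/lfunP => x; rewrite twist_lactE rmorph1 mul1r id_lfunE. Qed.

Lemma twist_lactM t a b :
  twist_lact t (a * b) = (twist_lact t a \o twist_lact t b)%VF.
Proof. by apply/lfunP => x; rewrite comp_lfunE !twist_lactE rmorphM mulrA. Qed.

Lemma twist_lractC t a b :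
  (twist_lact t a \o ract rreg b = ract rreg b \o twist_lact t a)%VF.
Proof.
apply/lfunP => x; rewrite [LHS]comp_lfunE [RHS]comp_lfunE.
rewrite -[LHS]/(twist_lact t a (linfun (@amulr k A) b x)).
rewrite -[RHS]/(linfun (@amulr k A) b (twist_lact t a x)).
by rewrite !twist_lactE !lfunE /= mulrA.
Qed.

(** {}_t A_1, with a.x = t(a)x and x.b = xb *)
Definition twist (t : 'AEnd(A)) : bimod :=
  @BiMod rreg (twist_lact t) (twist_lact1 t) (twist_lactM t) (twist_lractC t).

Lemma twist_ractE t a (x : A) : ract (twist t) a x = x * a.
Proof. by rewrite -[LHS]/(linfun (@amulr k A) a x) !lfunE. Qed.

Definition breg : bimod := twist \1%AF.

(** The tensor product of M and B over A is the quotient of M (x)_k B by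
    [balanced M B], the span of all x.a (x) y - x (x) a.y; by linearity it is
    enough to let a run over a basis of A. *)
Definition balanced (M : rmod) (B : bimod) : {vspace ktens M B} :=
  (\sum_(i < \dim {:A})
     limg (ktmap (ract M (vbasis {:A})`_i) \1
           - ktmap \1 (lact B (vbasis {:A})`_i)))%VS.

Definition tpure (M : rmod) (B : bimod) (x : M) (y : B) : quo (balanced M B) :=
  qpi (balanced M B) (kpure x y).

Lemma balanced_map (M M' : rmod) (B B' : bimod) (f : 'Hom(M, M'))
    (g : 'Hom(B, B')) :
  (forall a x, f (ract M a x) = ract M' a (f x)) ->
  (forall a y, g (lact B a y) = lact B' a (g y)) ->
  (ktmap f g @: balanced M B <= balanced M' B')%VS.
Proof.
move=> fA gA; rewrite limg_sum; apply/subv_sumP => i _.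
apply: (@subv_trans _ _ (limg (ktmap (ract M' (vbasis {:A})`_i) \1
           - ktmap \1 (lact B' (vbasis {:A})`_i)))); last first.
  exact: (sumv_sup i).
set a := (vbasis _)`_i; rewrite -limg_comp; set F := (_ \o _)%VF.
suff -> : F = ((ktmap (ract M' a) \1 - ktmap \1 (lact B' a)) \o ktmap f g)%VF.
  by rewrite limg_comp limgS // subvf.
apply: kt_ext => x y; rewrite !comp_lfunE !add_lfunE !opp_lfunE linearB /= !ktmapE.
by rewrite !id_lfunE fA gA.
Qed.

Lemma tpure_bal (M : rmod) (B : bimod) a (x : M) (y : B) :
  tpure (ract M a x) y = tpure x (lact B a y).
Proof.
apply/eqP; rewrite -subr_eq0 -linearB qpi_eq0.
pose F b := kpure (ract M b x) y - kpure x (lact B b y).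
rewrite -/(F a).
have FL : linear F.
  move=> c u v; rewrite /F !linearP /= !add_lfunE !scale_lfunE.
  by rewrite kpureDl kpureDr scalerBr opprD addrACA.
have LE b : linfun F b = F b by rewrite (linfunE FL).
rewrite -LE (coord_vbasis (memvf a)) linear_sum.
apply: memv_suml => i _; rewrite linearZ; apply: memvZ; rewrite /= LE.
apply: (subvP (sumv_sup i _ (subvv _))) => //.
apply/memv_imgP; exists (kpure x y); rewrite ?memvf //.
by rewrite add_lfunE opp_lfunE !ktmapE !id_lfunE.
Qed.

Lemma t_ext (M : rmod) (B : bimod) (N : vectType k)
    (f g : 'Hom(quo (balanced M B), N)) :
  (forall x y, f (tpure x y) = g (tpure x y)) -> f = g.
Proof.
move=> fg; have E : (f \o qpi (balanced M B))%VF = (g \o qpi (balanced M B))%VF.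
  by apply: kt_ext => x y; rewrite [LHS]comp_lfunE [RHS]comp_lfunE; apply: fg.
by apply/lfunP => z; rewrite -(qpiK z) -(comp_lfunE f) E comp_lfunE.
Qed.

Definition tlift (M : rmod) (B : bimod) (N : vectType k) (b : M -> B -> N) :
  'Hom(quo (balanced M B), N) := (ktlift b \o qsec (balanced M B))%VF.

Lemma tliftE (M : rmod) (B : bimod) (N : vectType k) (b : M -> B -> N) x y :
  (forall y, linear (b^~ y)) -> (forall x, linear (b x)) ->
  (forall a x y, b (ract M a x) y = b x (lact B a y)) ->
  tlift b (tpure x y) = b x y.
Proof.
move=> bl br bA; rewrite /tlift comp_lfunE -(ktliftE x y bl br).
have U0 : (balanced M B <= lker (ktlift b))%VS.
  apply/subv_sumP => i _; rewrite lkerE -limg_comp; set F := (_ \o _)%VF.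
  suff -> : F = 0 by rewrite -subv0; apply/subvP => z /memv_imgP[u _ ->]; rewrite zero_lfunE mem0v.
  apply: kt_ext => u v.
  rewrite comp_lfunE add_lfunE opp_lfunE linearB /= !ktmapE !id_lfunE !ktliftE // bA.
  by rewrite zero_lfunE subrr.
apply/esym/eqP; rewrite -subr_eq0 -linearB -memv_ker.
exact: (subvP U0 _ (qsecK _ _)).
Qed.

Definition tens_ract_fun (M : rmod) (B : bimod) (a : A) :=
  qmap (balanced M B) (balanced M B) (ktmap \1 (ract B a)).

Lemma tens_ract_funE (M : rmod) (B : bimod) a (x : M) (y : B) :
  tens_ract_fun M B a (tpure x y) = tpure x (ract B a y).
Proof.
rewrite /tens_ract_fun /tpure qmapE ?ktmapE ?id_lfunE //.
apply: balanced_map => [b z|b z]; first by rewrite !id_lfunE.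
by rewrite -!comp_lfunE lractC.
Qed.

Lemma tpure_linearl (M : rmod) (B : bimod) (y : B) :
  linear (fun x : M => tpure x y).
Proof. by move=> c u v; rewrite /tpure kpureDl linearP. Qed.

Lemma tpure_linearr (M : rmod) (B : bimod) (x : M) :
  linear (fun y : B => tpure x y).
Proof. by move=> c u v; rewrite /tpure kpureDr linearP. Qed.

Lemma tens_ract_linear (M : rmod) (B : bimod) : linear (tens_ract_fun M B).
Proof.
move=> c a b; apply: t_ext => x y.
rewrite add_lfunE scale_lfunE !tens_ract_funE linearP add_lfunE scale_lfunE.
exact: tpure_linearr.
Qed.

Definition tens_ract (M : rmod) (B : bimod) := linfun (tens_ract_fun M B).

Lemma tens_ractE (M : rmod) (B : bimod) a (x : M) (y : B) :
  tens_ract M B a (tpure x y) = tpure x (ract B a y).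
Proof. by rewrite /tens_ract (linfunE (@tens_ract_linear M B)) tens_ract_funE. Qed.

Lemma tens_ract1 (M : rmod) (B : bimod) : tens_ract M B 1 = \1%VF.
Proof. by apply: t_ext => x y; rewrite tens_ractE ract1 !id_lfunE. Qed.

Lemma tens_ractM (M : rmod) (B : bimod) a b :
  tens_ract M B (a * b) = (tens_ract M B b \o tens_ract M B a)%VF.
Proof. by apply: t_ext => x y; rewrite comp_lfunE !tens_ractE ractM comp_lfunE. Qed.

Definition tens (M : rmod) (B : bimod) : rmod :=
  RMod (@tens_ract1 M B) (@tens_ractM M B).

Definition tens_fun (M M' : rmod) (B B' : bimod) (f : rhom M M') (g : bhom B B') :
  'Hom(tens M B, tens M' B') :=
  qmap (balanced M B) (balanced M' B') (ktmap f g).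

Lemma tens_funE (M M' : rmod) (B B' : bimod) (f : rhom M M') (g : bhom B B') x y :
  tens_fun f g (tpure x y) = tpure (f x) (g y).
Proof.
rewrite /tens_fun /tpure qmapE ?ktmapE //.
by apply: balanced_map; [apply: rhomP | apply: bhomP].
Qed.

Lemma tens_funP (M M' : rmod) (B B' : bimod) (f : rhom M M') (g : bhom B B') a z :
  tens_fun f g (ract (tens M B) a z) = ract (tens M' B') a (tens_fun f g z).
Proof.
rewrite -!comp_lfunE; congr (fun_of_lfun _ _); apply: t_ext => x y.
by rewrite [LHS]comp_lfunE [RHS]comp_lfunE tens_funE !tens_ractE tens_funE rhomP.
Qed.

Definition tens_mor (M M' : rmod) (B B' : bimod) (f : rhom M M') (g : bhom B B') :
  rhom (tens M B) (tens M' B') := RHom (tens_funP f g).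

Definition bid (B : bimod) : bhom B B.
Proof. by exists (rid B) => a x; rewrite !id_lfunE. Defined.

(** The isomorphism from C (x)_A A to C, mapping c (x) a to c.a *)
Definition unitor_fun (C : rmod) : 'Hom(tens C breg, C) :=
  tlift (B := breg) (fun c (a : A) => ract C a c).

Lemma unitor_funE (C : rmod) (c : C) (a : A) :
  unitor_fun C (tpure (B := breg) c a) = ract C a c.
Proof.
rewrite /unitor_fun tliftE //.
- by move=> y b u v; rewrite linearP.
- by move=> x b u v; rewrite linearP add_lfunE scale_lfunE.
- by move=> b x y; rewrite -comp_lfunE -ractM twist_lactE id_lfunE.
Qed.

Lemma unitor_funP (C : rmod) a z :
  unitor_fun C (ract (tens C breg) a z) = ract C a (unitor_fun C z).
Proof.
rewrite -!comp_lfunE; congr (fun_of_lfun _ _); apply: t_ext => x y.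
rewrite [LHS]comp_lfunE [RHS]comp_lfunE tens_ractE !unitor_funE.
by rewrite twist_ractE ractM comp_lfunE.
Qed.

Definition unitor (C : rmod) : rhom (tens C breg) C := RHom (@unitor_funP C).

Section Restriction.
Variables (t : 'AEnd(A)) (N : rmod).
Let act : 'Hom(A, 'End(N)) := (ract N \o t)%VF.
Lemma rres1 : act 1 = \1%VF.
Proof. by rewrite comp_lfunE rmorph1 ract1. Qed.
Lemma rresM a b : act (a * b) = (act b \o act a)%VF.
Proof. by rewrite ![act _]comp_lfunE rmorphM ractM. Qed.
Definition rres : rmod := RMod rres1 rresM.
Lemma rresE a x : ract rres a x = ract N (t a) x.
Proof. by rewrite [ract rres a]comp_lfunE. Qed.
End Restriction.

Lemma tens_projective (P : rmod) (t : 'AEnd(A)) :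
  rprojective P -> rprojective (tens P (twist t)).
Proof.
move=> Pproj M N g f gS.
have gP a x : g (ract (rres t M) a x) = ract (rres t N) a (g x).
  by rewrite !rresE rhomP.
pose g' : rhom (rres t M) (rres t N) := @RHom (rres t M) (rres t N) g gP.
pose f0 : 'Hom(P, N) := linfun (fun x => f (tpure (B := twist t) x (1 : A))).
have f0E x : f0 x = f (tpure (B := twist t) x (1 : A)).
  by rewrite /f0 linfunE // => c u v; rewrite tpure_linearl linearP.
have pureE (x : P) (a : A) :
    tpure (B := twist t) x a
    = ract (tens P (twist t)) a (tpure (B := twist t) x (1 : A)).
  by rewrite tens_ractE twist_ractE mul1r.
have f0P a x : f0 (ract P a x) = ract (rres t N) a (f0 x).
  by rewrite !f0E rresE tpure_bal twist_lactE mulr1 pureE rhomP.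
have [h' hE] := Pproj _ _ g' (@RHom P (rres t N) f0 f0P) gS.
pose h0 : 'Hom(tens P (twist t), M) :=
  tlift (B := twist t) (fun x (a : A) => ract M a (h' x)).
have h0E (x : P) (a : A) : h0 (tpure (B := twist t) x a) = ract M a (h' x).
  rewrite /h0 tliftE //.
  - by move=> b c u v; rewrite !linearP.
  - by move=> u c v w; rewrite linearP add_lfunE scale_lfunE.
  - move=> b u v; rewrite rhomP rresE -comp_lfunE -ractM.
    by rewrite twist_lactE.
have hP a z : h0 (ract (tens P (twist t)) a z) = ract M a (h0 z).
  rewrite -!comp_lfunE; congr (fun_of_lfun _ _); apply: t_ext => x y.
  rewrite [LHS]comp_lfunE [RHS]comp_lfunE tens_ractE !h0E.
  by rewrite twist_ractE ractM comp_lfunE.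
exists (RHom hP); apply: t_ext => x y.
rewrite comp_lfunE /= h0E (rhomP g) pureE (rhomP f) -f0E.
congr (fun_of_lfun _ _).
by move: hE => /(congr1 (fun u : 'Hom(_, _) => u x)); rewrite comp_lfunE.
Qed.

Record projmod := ProjMod { pm :> rmod; pmP : rprojective pm }.

(** - (x)_A {}_t A_1, on objects of proj A and on morphisms *)
Definition pshift (t : 'AEnd(A)) (X : projmod) : projmod :=
  ProjMod (tens_projective (t := t) (@pmP X)).
Definition shift_mor (t : 'AEnd(A)) (M N : rmod) (f : rhom M N) :
  rhom (tens M (twist t)) (tens N (twist t)) := tens_mor f (bid (twist t)).

Section DirectSum.
Variables M N : rmod.

Definition rsum_act_fun (a : A) : 'End((M * N)%type) :=
  linfun (fun p : M * N => (ract M a p.1, ract N a p.2)).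

Lemma rsum_act_funE a p : rsum_act_fun a p = (ract M a p.1, ract N a p.2).
Proof. by rewrite linfunE // => c [u u'] [v v'] /=; rewrite !linearP. Qed.

Lemma rsum_act_linear : linear rsum_act_fun.
Proof.
move=> c a b; apply/lfunP => -[x y].
rewrite add_lfunE scale_lfunE !rsum_act_funE /= !linearP.
by rewrite !add_lfunE !scale_lfunE.
Qed.

Definition rsum_act : 'Hom(A, 'End((M * N)%type)) := linfun rsum_act_fun.

Lemma rsum_actE a p : rsum_act a p = (ract M a p.1, ract N a p.2).
Proof. by rewrite /rsum_act (linfunE rsum_act_linear) rsum_act_funE. Qed.

Lemma rsum_act1 : rsum_act 1 = \1%VF.
Proof. by apply/lfunP => -[x y]; rewrite rsum_actE !ract1 !id_lfunE. Qed.

Lemma rsum_actM a b : rsum_act (a * b) = (rsum_act b \o rsum_act a)%VF.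
Proof.
by apply/lfunP => -[x y]; rewrite comp_lfunE !rsum_actE !ractM !comp_lfunE.
Qed.

Definition rsum : rmod := RMod rsum_act1 rsum_actM.

End DirectSum.

Section DirectSumMor.
Variables (M N M' N' : rmod) (f : rhom M M') (g : rhom N N').

Definition rsum_mor_fun : 'Hom(rsum M N, rsum M' N') :=
  linfun (fun p : M * N => (f p.1, g p.2)).

Lemma rsum_mor_funE p : rsum_mor_fun p = (f p.1, g p.2).
Proof. by rewrite linfunE // => c [u u'] [v v'] /=; rewrite !linearP. Qed.

Lemma rsum_mor_funP a x :
  rsum_mor_fun (ract (rsum M N) a x) = ract (rsum M' N') a (rsum_mor_fun x).
Proof. by rewrite !rsum_mor_funE !rsum_actE /= !rhomP. Qed.

Definition rsum_mor : rhom (rsum M N) (rsum M' N') := RHom rsum_mor_funP.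

End DirectSumMor.

Lemma rsum_projective (P Q : rmod) :
  rprojective P -> rprojective Q -> rprojective (rsum P Q).
Proof.
move=> Pp Qp M N g f gS.
pose i1 : 'Hom(P, rsum P Q) := linfun (fun x : P => (x, 0 : Q)).
pose i2 : 'Hom(Q, rsum P Q) := linfun (fun y : Q => (0 : P, y)).
have i1E x : i1 x = (x, 0).
  by rewrite /i1 linfunE // => c u v; congr pair; rewrite /= scaler0 addr0.
have i2E x : i2 x = (0, x).
  by rewrite /i2 linfunE // => c u v; congr pair; rewrite /= scaler0 addr0.
have i1P a x : i1 (ract P a x) = ract (rsum P Q) a (i1 x).
  by rewrite !i1E rsum_actE /= linear0.
have i2P a x : i2 (ract Q a x) = ract (rsum P Q) a (i2 x).
  by rewrite !i2E rsum_actE /= linear0.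
have f1P a x : (f \o i1)%VF (ract P a x) = ract N a ((f \o i1)%VF x).
  by rewrite !comp_lfunE i1P rhomP.
have f2P a x : (f \o i2)%VF (ract Q a x) = ract N a ((f \o i2)%VF x).
  by rewrite !comp_lfunE i2P rhomP.
have [h1 h1E] := Pp _ _ g (RHom f1P) gS.
have [h2 h2E] := Qp _ _ g (RHom f2P) gS.
pose h : 'Hom(rsum P Q, M) := linfun (fun p : P * Q => h1 p.1 + h2 p.2).
have hE p : h p = h1 p.1 + h2 p.2.
  by rewrite /h linfunE // => c u v /=; rewrite !linearP /= scalerDr addrACA.
have hP a p : h (ract (rsum P Q) a p) = ract M a (h p).
  by rewrite !hE rsum_actE /= !rhomP linearD.
have e1 x : g (h1 x) = f (i1 x) by rewrite -!comp_lfunE h1E.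
have e2 x : g (h2 x) = f (i2 x) by rewrite -!comp_lfunE h2E.
exists (RHom hP); apply/lfunP => -[x y]; rewrite comp_lfunE /= hE.
transitivity (g (h1 x) + g (h2 y)); first exact: linearD.
rewrite e1 e2; transitivity (f (i1 x + i2 y)); first by rewrite linearD.
by rewrite i1E i2E; congr (fun_of_lfun _ _); congr pair; rewrite /= ?addr0 ?add0r.
Qed.

Definition psum (X Y : projmod) : projmod :=
  ProjMod (rsum_projective (@pmP X) (@pmP Y)).

Section RightIdeal.
Variable e : A.
Let U : {vspace A} := limg (amull e).
Definition rideal_act_fun (a : A) : 'End(subvs_of U) :=
  (linfun (vsproj U) \o amulr a \o linfun vsval)%VF.

Lemma rideal_act_funE a x : vsval (rideal_act_fun a x) = vsval x * a.
Proof.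
rewrite /rideal_act_fun !comp_lfunE /= !lfunE /= vsprojK //.
case: x => _ /= /memv_imgP[y _ ->].
by apply/memv_imgP; exists (y * a); rewrite ?memvf // !lfunE /= mulrA.
Qed.

Lemma rideal_act_linear : linear rideal_act_fun.
Proof.
move=> c a b; rewrite /rideal_act_fun linearP comp_lfunDr comp_lfunDl.
by rewrite -comp_lfunZr -comp_lfunZl.
Qed.

Definition rideal_act : 'Hom(A, 'End(subvs_of U)) := linfun rideal_act_fun.

Lemma rideal_actE a x : vsval (rideal_act a x) = vsval x * a.
Proof. by rewrite /rideal_act (linfunE rideal_act_linear) rideal_act_funE. Qed.

Lemma rideal_act1 : rideal_act 1 = \1%VF.
Proof.
by apply/lfunP => x; apply: val_inj; rewrite /= rideal_actE mulr1 id_lfunE.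
Qed.

Lemma rideal_actM a b : rideal_act (a * b) = (rideal_act b \o rideal_act a)%VF.
Proof.
apply/lfunP => x; apply: val_inj; rewrite /= comp_lfunE !rideal_actE.
by rewrite mulrA.
Qed.

Definition rideal : rmod := RMod rideal_act1 rideal_actM.
End RightIdeal.

Definition primitive_idem (e : A) : Prop :=
  [/\ e * e = e, e != 0 &
      forall f g : A, f * f = f -> g * g = g -> f * g = 0 -> g * f = 0 ->
        e = f + g -> f = 0 \/ g = 0].

Definition basic_algebra : Prop :=
  exists (n : nat) (e : 'I_n -> A),
    [/\ forall i, primitive_idem (e i),
        forall i j, i != j -> e i * e j = 0,
        \sum_i e i = 1
      & forall i j, risom (rideal (e i)) (rideal (e j)) -> i = j].

Definition projective_cover (P M : bimod) (p : bhom P M) : Prop :=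
  [/\ bprojective P, surjl p &
      forall (N : bimod) (h : bhom N P), surjl (p \o h)%VF -> surjl h].

(** N is isomorphic to the n-th syzygy of M, computed with projective covers of
    bimodules. *)
Fixpoint is_syzygy (n : nat) (M N : bimod) : Prop :=
  if n is n'.+1 then
    exists (K P : bimod) (i : bhom K P) (p : bhom P M),
      [/\ projective_cover p, injl i, exact_at i p & is_syzygy n' K N]
  else bisom M N.

Definition twisted_periodic (n : nat) (s : algaut) : Prop :=
  is_syzygy n breg (twist (aut_inv s)).

(** Data of a sequence 0 -> L -> E_0 -> ... -> E_d -> F -> C -> 0 of right
    modules; the [emid i] and [edif i] with i > d and i >= d, respectively, play
    no role. *)
Record ext (d : nat) (L C : rmod) := Ext {
  emid : nat -> rmod;
  elast : rmod;
  einc : rhom L (emid 0);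
  edif : forall i, rhom (emid i) (emid i.+1);
  edl : rhom (emid d) elast;
  eaug : rhom elast C }.

Definition eimg d L C (E : ext d L C) (i : nat) : {vspace emid E i} :=
  match i with 0 => limg (einc E) | j.+1 => limg (edif E j) end.

Definition ext_exact d L C (E : ext d L C) : Prop :=
  [/\ injl (einc E), forall i, (i < d)%N -> eimg E i = lker (edif E i),
      eimg E d = lker (edl E), exact_at (edl E) (eaug E) & surjl (eaug E)].

(** E and E' are exact and there is a morphism from E to E' that is the identity
    on L and on C. *)
Definition ext_step d L C (E E' : ext d L C) : Prop :=
  ext_exact E /\ ext_exact E' /\
  exists (h : forall i, rhom (emid E i) (emid E' i)) (hl : rhom (elast E) (elast E')),
    [/\ (h 0 \o einc E)%VF = einc E',
        forall i, (i < d)%N -> (h i.+1 \o edif E i = edif E' i \o h i)%VF,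
        (hl \o edl E = edl E' \o h d)%VF
      & (eaug E' \o hl)%VF = eaug E].

(** Equality of the classes in the Yoneda group Ext_A^{d+2}(C, L) *)
Definition ext_equiv d L C : ext d L C -> ext d L C -> Prop :=
  clos_refl_sym_trans (ext d L C) (@ext_step d L C).

(** Data of a sequence 0 -> L -> P_{d+1} -> ... -> P_1 -> P_0 -> C -> 0 of
    bimodules, with [bemid i] in the place of P_{d+1-i} and [belast] in the
    place of P_0. *)
Record bext (d : nat) (L C : bimod) := BExt {
  bemid : nat -> bimod;
  belast : bimod;
  beinc : bhom L (bemid 0);
  bedif : forall i, bhom (bemid i) (bemid i.+1);
  bedl : bhom (bemid d) belast;
  beaug : bhom belast C }.

Definition bext_right d L C (E : bext d L C) : ext d L C :=
  @Ext d L C (bemid E) (belast E) (beinc E) (bedif E) (bedl E) (beaug E).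

Definition bprojinj (B : bimod) : Prop := bprojective B /\ binjective B.

Definition periodicity_seq d (s : algaut) (th : bext d (twist (aut_inv s)) breg) :
    Prop :=
  [/\ ext_exact (bext_right th), forall i, (i <= d)%N -> bprojinj (bemid th i)
    & bprojinj (belast th)].

(** C (x)_A theta, with C (x)_A A identified with C *)
Definition tens_ext d L (th : bext d L breg) (C : rmod) : ext d (tens C L) C :=
  let T (B B' : bimod) (f : bhom B B') := tens_mor (rid C) f in
  @Ext d (tens C L) C (fun i => tens C (bemid th i)) (tens C (belast th))
    (T _ _ (beinc th)) (fun i => T _ _ (bedif th i)) (T _ _ (bedl th))
    (rcomp (unitor C) (T _ _ (beaug th))).

End Modules.

Section Angles.
Variables (k : fieldType) (A : falgType k) (d : nat) (s : algaut A).
Variable th : bext d (twist (aut_inv s)) (breg A).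

(** Data of a sequence X_0 -> X_1 -> ... -> X_{d+1} -> Sigma_d X_0 in proj A;
    the [sob i] with i > d+1 and the [smor i] with i > d play no role. *)
Record dseq := DSeq {
  sob : nat -> projmod A;
  smor : forall i, rhom (sob i) (sob i.+1);
  slast : rhom (sob d.+1) (pshift s (sob 0)) }.

Definition angle_C1 (S : dseq) : Prop :=
  [/\ forall i, (i < d)%N -> exact_at (smor S i) (smor S i.+1),
      exact_at (smor S d) (slast S)
    & exact_at (slast S) (shift_mor s (smor S 0))].

(** The isomorphism from X to Sigma_d^{-1} Sigma_d X *)
Definition shift_unit (X : rmod A) (x : X) :
    tens (tens X (twist s)) (twist (aut_inv s)) :=
  tpure (M := tens X (twist s)) (B := twist (aut_inv s))
    (tpure (B := twist s) x (1 : A)) (1 : A).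

Definition angle_ext (S : dseq) (C : rmod A) (p : rhom (pshift s (sob S 0)) C)
    (i : rhom (tens C (twist (aut_inv s))) (sob S 1)) :
    ext d (tens C (twist (aut_inv s))) C :=
  @Ext k A d (tens C (twist (aut_inv s))) C
    (fun j => sob S j.+1) (pshift s (sob S 0)) i (fun j => smor S j.+1)
    (slast S) p.

Definition angle_C2 (S : dseq) : Prop :=
  exists (C : rmod A) (p : rhom (pshift s (sob S 0)) C),
    [/\ surjl p, exact_at (slast S) p
      & exists i : rhom (tens C (twist (aut_inv s))) (sob S 1),
        [/\ forall x, smor S 0 x = i (shift_mor (aut_inv s) p (shift_unit x)),
            ext_exact (angle_ext p i)
          & ext_equiv (angle_ext p i) (tens_ext th C)]].

Definition angle (S : dseq) : Prop := angle_C1 S /\ angle_C2 S.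

Record rankfn (R : realType) := RankFn {
  rk :> forall X Y : projmod A, rhom X Y -> R;
  rk_ge0 : forall (X Y : projmod A) (f : rhom X Y), 0 <= rk f;
  rk_RM0 : forall (X Y X' Y' : projmod A) (f : rhom X Y) (g : rhom X' Y')
      (psi : rhom X X') (phi : rhom Y Y'),
    is_riso psi -> is_riso phi -> (phi \o f = g \o psi)%VF -> rk f = rk g;
  rk_RM1 : forall (X Y X' Y' : projmod A) (f : rhom X Y) (g : rhom X' Y'),
    @rk (psum X X') (psum Y Y') (rsum_mor f g) = rk f + rk g;
  rk_RM2 : forall S : dseq, angle S ->
    (forall i, (i < d)%N ->
       rk (smor S i) - rk (rid (sob S i.+1)) + rk (smor S i.+1) = 0) /\
    rk (smor S d) - rk (rid (sob S d.+1)) + rk (slast S) = 0;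
  rk_RM3 : forall (X Y : projmod A) (f : rhom X Y),
    @rk (pshift s X) (pshift s Y) (shift_mor s f) = rk f }.

End Angles.

Section Decomposition.
Variables (k : fieldType) (A : falgType k) (d : nat) (s : algaut A).
Variable th : bext d (twist (aut_inv s)) (breg A).
Variable R : realType.
Local Notation rankfn := (rankfn th R).

Definition rk_eq (r r' : rankfn) : Prop :=
  forall (X Y : projmod A) (f : rhom X Y), r X Y f = r' X Y f.

Definition rk_zero (r : rankfn) : Prop :=
  forall (X Y : projmod A) (f : rhom X Y), r X Y f = 0.

Definition rk_integral (r : rankfn) : Prop :=
  forall (X Y : projmod A) (f : rhom X Y), r X Y f \is a Num.int.

Definition rk_irreducible (r : rankfn) : Prop :=
  [/\ ~ rk_zero r, rk_integral r &
      forall r1 r2 : rankfn, rk_integral r1 -> rk_integral r2 ->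
        (forall (X Y : projmod A) (f : rhom X Y), r X Y f = r1 X Y f + r2 X Y f) ->
        rk_zero r1 \/ rk_zero r2].

Definition rk_lfsum (I : choiceType) (ri : I -> rankfn) (r : rankfn) : Prop :=
  forall (X Y : projmod A) (f : rhom X Y),
    finite_set [set i | ri i X Y f != 0]%classic /\
    r X Y f = \sum_(i \in [set: I]%classic) ri i X Y f.

End Decomposition.

(* Main.v *)
(** A rank function r is determined by the additive function phi on mod A with
    r f = phi (image f); conversely every nonnegative Sigma_d-invariant additive
    function phi defines a rank function. Additive functions are determined by
    their values on the simple modules, so integral rank functions correspond to
    functions with values in nat on the orbits of Sigma_d on the finite set of
    isomorphism classes of simple modules, and the irreducible ones to the
    indicator functions of orbits.

    The value r f =: n(M) depends only on the image M of f: if f and g have the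
    same image then f (+) 0 and 0 (+) g differ by automorphisms, because
    projectives are injective. For additivity, C (x) theta yields an angle whose
    terms are exact functors of C. As d is odd, (RM2) makes n(C) - n(Omega C) an
    additive function of C, while n(Omega C) + n(Omega^2 C) = n(C (x) P_1) is
    additive too; comparing the two for Omega C by Schanuel's lemma shows that
    2 n(Omega C), and hence n(C), is additive. *)

Require Import Defs.
From mathcomp Require Import all_boot all_order all_algebra all_field.
From mathcomp Require Import finmap all_classical all_reals.
From mathcomp Require Import zify ring lra.
From Stdlib Require Import Relation_Operators.

Set Implicit Arguments.
Unset Strict Implicit.
Unset Printing Implicit Defensive.

Import Order.TTheory GRing.Theory Num.Theory.
Import VectorInternalTheory.
Local Open Scope ring_scope.

(** * Kernels, images and exactness of linear maps *)

Section LinearMaps.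
Variable k : fieldType.
Implicit Types V W U : vectType k.

(** As C (x)_A - is only right exact, exactness of C (x) theta needs a reason: theta ends in A and
    its middle terms are projective as left modules, so it splits over left modules. The splitting
    is carried by left linear quasi-inverses, which survive tensoring. The obstacle to additivity is
    that ranks of modules are computed through resolutions, while the syzygy of C is not a functor
    of C. The way out is a formula for n(C) that contains only ranks of projective modules obtained
    from C by the exact functors - (x)_A P_j; its factor 1/2 is harmless since ranks are real
    numbers. On the side of simple modules the field k is arbitrary, so the multiplicity of S_i in M
    is dim M e_i / dim S_i e_i, and being basic is what makes i |-> S_i injective. Existence and
    uniqueness of the decomposition are both read off at test morphisms whose image is a single
    simple module, since these return single weights of a rank function. *)

Lemma injlP V W (f : 'Hom(V, W)) : injl f <-> forall x, f x = 0 -> x = 0.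
Proof.
split=> [/lker0P fI x fx0|f0]; first by apply: fI; rewrite fx0 linear0.
apply/lker0P => x y fxy; apply/eqP; rewrite -subr_eq0; apply/eqP/f0.
by rewrite linearB /= fxy subrr.
Qed.

Lemma surjlP V W (f : 'Hom(V, W)) : surjl f <-> forall y, exists x, y = f x.
Proof.
split=> [/eqP fS y|fS].
  by have := memvf y; rewrite -fS => /memv_imgP[x _ ->]; exists x.
rewrite /surjl eqEsubv subvf; apply/subvP => y _.
by have [x ->] := fS y; apply: memv_img; apply: memvf.
Qed.

Lemma exact_atP V W U (f : 'Hom(V, W)) (g : 'Hom(W, U)) :
  exact_at f g <->
  (forall x, g (f x) = 0) /\ (forall y, g y = 0 -> exists x, y = f x).
Proof.
split=> [/eqP fg|[gf0 gf]].
  split=> [x|y]; first by apply/eqP; rewrite -memv_ker -fg memv_img ?memvf.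
  by move/eqP; rewrite -memv_ker -fg => /memv_imgP[x _ ->]; exists x.
rewrite /exact_at eqEsubv; apply/andP; split; apply/subvP => y.
  by case/memv_imgP => x _ ->; rewrite memv_ker gf0.
rewrite memv_ker => /eqP /gf[x ->]; apply: memv_img; exact: memvf.
Qed.

Lemma limg_sub_lift V W U (f : 'Hom(V, W)) (u : 'Hom(U, W)) :
  (limg u <= limg f)%VS -> (f \o (f^-1 \o u) = u)%VF.
Proof.
move=> /subvP uf; apply/lfunP => x; rewrite !comp_lfunE limg_lfunVK //.
by apply/uf/memv_img/memvf.
Qed.

Lemma surjl_lfunVK V W (f : 'Hom(V, W)) y : surjl f -> f ((f^-1)%VF y) = y.
Proof. by move=> /eqP fS; rewrite limg_lfunVK // fS memvf. Qed.

Lemma injl_lfunK V W (f : 'Hom(V, W)) x : injl f -> (f^-1)%VF (f x) = x.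
Proof. by move=> fI; apply: (lker0_lfunK fI). Qed.

End LinearMaps.

(** * Submodules, quotients and image factorisations of module maps *)

Section Modules.
Variables (k : fieldType) (A : falgType k).
Implicit Types M N L : rmod A.

Definition rhom_of M N (f : M -> N) (fL : linear f)
    (fA : forall a x, f (ract M a x) = ract N a (f x)) : rhom M N.
Proof. by exists (linfun f) => a x; rewrite !(linfunE fL). Defined.

Lemma rhom_ofE M N (f : M -> N) fL fA x : @rhom_of M N f fL fA x = f x.
Proof. by rewrite /= (linfunE fL). Qed.

Definition rzero_hom M N : rhom M N.
Proof. by exists 0 => a x; rewrite !zero_lfunE linear0. Defined.

Definition radd M N (f g : rhom M N) : rhom M N.
Proof. by exists (rfun f + rfun g) => a x; rewrite !add_lfunE !rhomP linearD. Defined.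

Definition ropp M N (f : rhom M N) : rhom M N.
Proof. by exists (- rfun f) => a x; rewrite !opp_lfunE !rhomP linearN. Defined.

Lemma rcompE L M N (g : rhom M N) (f : rhom L M) x : rcomp g f x = g (f x).
Proof. by rewrite /= comp_lfunE. Qed.

Lemma is_risoP M N (f : rhom M N) :
  is_riso f <-> exists g : rhom N M, cancel f g /\ cancel g f.
Proof.
split=> -[g [gf fg]]; exists g; split.
- by move=> x; rewrite -(comp_lfunE g) gf id_lfunE.
- by move=> x; rewrite -(comp_lfunE f) fg id_lfunE.
- by apply/lfunP => x; rewrite comp_lfunE gf id_lfunE.
- by apply/lfunP => x; rewrite comp_lfunE fg id_lfunE.
Qed.

Lemma bij_riso M N (f : rhom M N) : injl f -> surjl f -> is_riso f.
Proof.
move=> fI fS; have fK x := injl_lfunK x fI; have fVK y := surjl_lfunVK y fS.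
have gP a y : (f^-1)%VF (ract N a y) = ract M a ((f^-1)%VF y).
  by rewrite -{1}(fVK y) -rhomP fK.
apply/is_risoP; exists (RHom gP); split=> x; [exact: fK|exact: fVK].
Qed.

Lemma riso_inj M N (f : rhom M N) : is_riso f -> injl f.
Proof.
move=> /is_risoP[g [fK _]]; apply/injlP => x fx0.
by rewrite -(fK x) fx0 linear0.
Qed.

Lemma riso_surj M N (f : rhom M N) : is_riso f -> surjl f.
Proof. by move=> /is_risoP[g [_ gK]]; apply/surjlP => y; exists (g y); rewrite gK. Qed.

Lemma riso_id M : is_riso (rid M).
Proof. by exists (rid M); rewrite comp_lfun1l. Qed.

Lemma riso_comp L M N (g : rhom M N) (f : rhom L M) :
  is_riso g -> is_riso f -> is_riso (rcomp g f).
Proof.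
move=> gi fi; apply: bij_riso.
  apply/injlP => x; rewrite rcompE => /(injlP _).1-/(_ (riso_inj gi)).
  by move/(injlP _).1; apply; apply: riso_inj.
apply/surjlP => z; have [y ->] := (surjlP _).1 (riso_surj gi) z.
have [x ->] := (surjlP _).1 (riso_surj fi) y.
by exists x; rewrite rcompE.
Qed.

Definition stable M (U : {vspace M}) :=
  forall a x, x \in U -> ract M a x \in U.

Section Sub.
Variables (M : rmod A) (U : {vspace M}) (sU : stable U).

Definition rsub_act_fun (a : A) : 'End(subvs_of U) :=
  (linfun (vsproj U) \o ract M a \o linfun vsval)%VF.

Lemma rsub_act_funE a x : vsval (rsub_act_fun a x) = ract M a (vsval x).
Proof. by rewrite /rsub_act_fun !comp_lfunE /= !lfunE /= vsprojK // sU ?subvsP. Qed.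

Lemma rsub_act_linear : linear rsub_act_fun.
Proof.
move=> c a b; rewrite /rsub_act_fun linearP comp_lfunDr comp_lfunDl.
by rewrite -comp_lfunZr -comp_lfunZl.
Qed.

Lemma rsub_actE a x : vsval (linfun rsub_act_fun a x) = ract M a (vsval x).
Proof. by rewrite (linfunE rsub_act_linear) rsub_act_funE. Qed.

Lemma rsub_act1 : linfun rsub_act_fun 1 = \1%VF.
Proof.
by apply/lfunP => x; apply: val_inj; rewrite /= rsub_actE ract1 !id_lfunE.
Qed.

Lemma rsub_actM a b : linfun rsub_act_fun (a * b)
  = (linfun rsub_act_fun b \o linfun rsub_act_fun a)%VF.
Proof.
apply/lfunP => x; apply: val_inj; rewrite /= comp_lfunE !rsub_actE.
by rewrite ractM comp_lfunE.
Qed.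

Definition rsub : rmod A := RMod rsub_act1 rsub_actM.

Definition rincl : rhom rsub M.
Proof. by exists (linfun vsval) => a x; rewrite !lfunE /= rsub_actE. Defined.

Lemma rinclE x : rincl x = vsval x.
Proof. by rewrite /= lfunE. Qed.

Lemma rincl_inj : injl rincl.
Proof.
by apply/injlP => x; rewrite rinclE => x0; apply: val_inj; rewrite /= x0.
Qed.

Lemma limg_rincl : limg rincl = U.
Proof.
apply/eqP; rewrite eqEsubv; apply/andP; split; apply/subvP => y.
  by case/memv_imgP => x _ ->; rewrite rinclE subvsP.
move=> yU; apply/memv_imgP; exists (vsproj U y); rewrite ?memvf //.
by rewrite rinclE vsprojK.
Qed.

Lemma dim_rsub : \dim {:rsub} = \dim U.
Proof. by rewrite -[in RHS]limg_rincl limg_dim_eq // capfv; apply/eqP/rincl_inj. Qed.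

Lemma rsub_corestr N (f : rhom N M) : (limg f <= U)%VS ->
  exists g : rhom N rsub, forall x, rincl (g x) = f x.
Proof.
move=> /subvP fU; have gE x : vsval ((linfun (vsproj U) \o f)%VF x) = f x.
  by rewrite comp_lfunE lfunE /= vsprojK // fU ?memv_img ?memvf.
have gP a x : (linfun (vsproj U) \o f)%VF (ract N a x)
    = ract rsub a ((linfun (vsproj U) \o f)%VF x).
  by apply: val_inj; rewrite /= gE rsub_actE gE rhomP.
by exists (@RHom k A N rsub _ gP) => x; rewrite rinclE gE.
Qed.

Lemma rquo_act_linear : linear (fun a => qmap U U (ract M a)).
Proof.
move=> c a b; rewrite /qmap linearP comp_lfunDr comp_lfunDl.
by rewrite -comp_lfunZr -comp_lfunZl.
Qed.

Lemma rquo_actE a v :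
  linfun (fun a => qmap U U (ract M a)) a (qpi U v) = qpi U (ract M a v).
Proof.
rewrite (linfunE rquo_act_linear) qmapE //.
by apply/subvP => _ /memv_imgP[x xU ->]; apply: sU.
Qed.

Lemma rquo_act1 : linfun (fun a => qmap U U (ract M a)) 1 = \1%VF.
Proof. by apply/lfunP => x; rewrite -(qpiK x) rquo_actE ract1 !id_lfunE. Qed.

Lemma rquo_actM a b : linfun (fun a => qmap U U (ract M a)) (a * b)
  = (linfun (fun a => qmap U U (ract M a)) b
       \o linfun (fun a => qmap U U (ract M a)) a)%VF.
Proof.
by apply/lfunP => x; rewrite -(qpiK x) comp_lfunE !rquo_actE ractM comp_lfunE.
Qed.

Definition rquo : rmod A := RMod rquo_act1 rquo_actM.

Definition rproj : rhom M rquo.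
Proof. by exists (qpi U) => a x; rewrite [in RHS]rquo_actE. Defined.

Lemma rproj_surj : surjl rproj.
Proof. by apply/surjlP => y; exists (qsec U y); rewrite [in RHS]qpiK. Qed.

Lemma lker_rproj : lker rproj = U.
Proof. by apply/vspaceP => x; rewrite memv_ker qpi_eq0. Qed.

Lemma dim_rquo : (\dim U + \dim {:rquo} = \dim {:M})%N.
Proof.
have /eqP <- := rproj_surj; rewrite -[X in (\dim X + _)%N]lker_rproj.
by rewrite -(limg_ker_dim rproj fullv) capfv.
Qed.

End Sub.

Lemma limg_stable M N (f : rhom M N) : stable (limg f).
Proof.
move=> a _ /memv_imgP[x _ ->]; rewrite -rhomP.
by apply: memv_img; apply: memvf.
Qed.

Lemma lker_stable M N (f : rhom M N) : stable (lker f).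
Proof. by move=> a x; rewrite !memv_ker rhomP => /eqP ->; rewrite linear0. Qed.

Arguments limg_stable {M N} f.
Arguments lker_stable {M N} f.

Definition rimg M N (f : rhom M N) : rmod A := rsub (limg_stable f).

Definition ses M N L (i : rhom M N) (p : rhom N L) :=
  [/\ injl i, exact_at i p & surjl p].

Lemma ses_sub M (U : {vspace M}) (sU : stable U) : ses (rincl sU) (rproj sU).
Proof.
split; [exact: rincl_inj| |exact: rproj_surj].
by rewrite /exact_at limg_rincl lker_rproj.
Qed.

(** M is isomorphic to the image of f *)
Definition fac X Y (f : rhom X Y) M :=
  exists (p : rhom X M) (i : rhom M Y),
    [/\ surjl p, injl i & forall x, f x = i (p x)].

Lemma fac_rimg X Y (f : rhom X Y) : fac f (rimg f).
Proof.
have [g gE] := rsub_corestr (limg_stable f) (subvv (limg f)).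
exists g, (rincl (limg_stable f)); split=> //; last exact: rincl_inj.
apply/surjlP => y; have := subvsP y => /memv_imgP[x _ yE].
by exists x; apply: val_inj; rewrite /= yE -gE rinclE.
Qed.

Lemma fac_surj X Y (f : rhom X Y) : surjl f -> fac f Y.
Proof.
move=> fS; exists f, (rid Y); split=> //; first exact/riso_inj/riso_id.
by move=> x; rewrite /= id_lfunE.
Qed.

End Modules.

Arguments limg_stable {k A M N} f.
Arguments lker_stable {k A M N} f.

(** * The shift functors, seen through the bijection x |-> x (x) 1 *)

Section Shift.
Variables (k : fieldType) (A : falgType k).
Implicit Types (M N L : rmod A) (s t : algaut A).

(** Along this k-linear bijection the shift is M with its action twisted by the inverse of t, see
    [tone_ract]; statements on shifts are thereby reduced to elements [tone t M x]. *)
Definition tone t M : 'Hom(M, tens M (twist t)) :=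
  linfun (fun x => tpure (B := twist t) x (1 : A)).

Lemma toneE t M x : tone t M x = tpure (B := twist t) x (1 : A).
Proof. by rewrite /tone linfunE // => c u v; apply: tpure_linearl. Qed.

Lemma twist_tpureE t M x (b : A) :
  tpure (B := twist t) x b = ract (tens M (twist t)) b (tone t M x).
Proof. by rewrite toneE tens_ractE twist_ractE mul1r. Qed.

Lemma tone_ract t M a x :
  tone t M (ract M a x) = ract (tens M (twist t)) (t a) (tone t M x).
Proof. by rewrite -twist_tpureE toneE tpure_bal twist_lactE mulr1. Qed.

Lemma tone_surj t M : surjl (tone t M).
Proof.
have tVK a : t ((t^-1)%VF a) = a by rewrite lker0_lfunVK ?aut_inj.
(* The inverse of [tone] sends x (x) b to x.t^-1(b). *)
apply/surjlP => z; exists (tlift (B := twist t)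
  (fun x (b : A) => ract M ((t^-1)%VF b) x) z).
rewrite -(comp_lfunE (tone t M)) -[LHS](id_lfunE z).
congr (fun_of_lfun _ _); apply: t_ext => x b.
rewrite [RHS]comp_lfunE [LHS]id_lfunE tliftE.
- by rewrite tone_ract tVK -twist_tpureE.
- by move=> y c u v; rewrite linearP.
- by move=> u c v w; rewrite !linearP add_lfunE scale_lfunE.
- move=> a y b'; rewrite -comp_lfunE -ractM twist_lactE.
  congr (ract M _ _); rewrite -[a in LHS](lker0_lfunK (aut_inj t)).
  by rewrite -[LHS](rmorphM (aut_inv t)).
Qed.

Lemma tone_inj t M : injl (tone t M).
Proof.
have tK a : (t^-1)%VF (t a) = a by rewrite lker0_lfunK ?aut_inj.
pose b x (b : A) := ract M ((t^-1)%VF b) x.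
apply/injlP => x /(congr1 (tlift (B := twist t) b)).
rewrite linear0 toneE tliftE /b.
- by rewrite -(rmorph1 t) tK ract1 id_lfunE.
- by move=> y c u v; rewrite linearP.
- by move=> u c v w; rewrite !linearP add_lfunE scale_lfunE.
- move=> a y b'; rewrite -comp_lfunE -ractM twist_lactE.
  congr (ract M _ _); rewrite -[a in LHS](lker0_lfunK (aut_inj t)).
  by rewrite -[LHS](rmorphM (aut_inv t)).
Qed.

Lemma shift_morE t M N (f : rhom M N) x :
  shift_mor t f (tone t M x) = tone t N (f x).
Proof. by rewrite !toneE [LHS]tens_funE /= id_lfunE. Qed.

Lemma shift_inj t M N (f : rhom M N) : injl f -> injl (shift_mor t f).
Proof.
move=> fI; apply/injlP => z; have [x ->] := (surjlP _).1 (tone_surj t M) z.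
rewrite shift_morE => /((injlP _).1 (tone_inj t N)).
by move/((injlP _).1 fI) ->; rewrite linear0.
Qed.

Lemma shift_surj t M N (f : rhom M N) : surjl f -> surjl (shift_mor t f).
Proof.
move=> fS; apply/surjlP => z; have [y ->] := (surjlP _).1 (tone_surj t N) z.
by have [x ->] := (surjlP _).1 fS y; exists (tone t M x); rewrite shift_morE.
Qed.

Lemma shift_fac t X Y (f : rhom X Y) M :
  fac f M -> fac (shift_mor t f) (tens M (twist t)).
Proof.
move=> [p [i [pS iI fE]]]; exists (shift_mor t p), (shift_mor t i).
split; [exact: shift_surj|exact: shift_inj|] => z.
by have [x ->] := (surjlP _).1 (tone_surj t X) z; rewrite !shift_morE fE.
Qed.

Lemma shift_exact t L M N (f : rhom L M) (g : rhom M N) :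
  exact_at f g -> exact_at (shift_mor t f) (shift_mor t g).
Proof.
move=> /exact_atP[gf0 gf]; apply/exact_atP; split=> z.
  by have [x ->] := (surjlP _).1 (tone_surj t L) z; rewrite !shift_morE gf0 linear0.
have [y ->] := (surjlP _).1 (tone_surj t M) z; rewrite shift_morE.
move=> /((injlP _).1 (tone_inj t N)) /gf[x ->]; exists (tone t L x).
by rewrite shift_morE.
Qed.

Lemma shift_ses t L M N (f : rhom L M) (g : rhom M N) :
  ses f g -> ses (shift_mor t f) (shift_mor t g).
Proof.
by case=> fI fg gS; split; [exact: shift_inj|exact: shift_exact|exact: shift_surj].
Qed.

(** The shift is full because conjugation by the bijection [tone] cancels the twist on both
    sides. *)
Lemma shift_rhom_reflect t M N (g : rhom (tens M (twist t)) (tens N (twist t))) :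
  exists f : rhom M N, forall x, tone t N (f x) = g (tone t M x).
Proof.
have tN y : tone t N (((tone t N)^-1)%VF y) = y.
  by apply: surjl_lfunVK; apply: tone_surj.
pose f := ((tone t N)^-1 \o g \o tone t M)%VF.
have fE x : tone t N (f x) = g (tone t M x) by rewrite !comp_lfunE tN.
have fP a x : f (ract M a x) = ract N a (f x).
  apply/eqP; rewrite -subr_eq0; apply/eqP/((injlP _).1 (tone_inj t N)).
  by rewrite linearB /= tone_ract !fE tone_ract rhomP subrr.
by exists (RHom fP).
Qed.

Lemma shift_riso_reflect t M N :
  risom (tens M (twist t)) (tens N (twist t)) -> risom M N.
Proof.
move=> [g gi]; have [f fE] := shift_rhom_reflect g.
exists f; apply: bij_riso.
  apply/injlP => x fx0; apply: ((injlP _).1 (tone_inj t M)).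
  by apply: ((injlP _).1 (riso_inj gi)); rewrite -fE fx0 linear0.
apply/surjlP => y.
have [z zE] := (surjlP _).1 (riso_surj gi) (tone t N y).
have [x xE] := (surjlP _).1 (tone_surj t M) z; exists x.
apply/eqP; rewrite -subr_eq0; apply/eqP/((injlP _).1 (tone_inj t N)).
by rewrite linearB /= fE -xE -zE subrr.
Qed.

Section Unit.
Variables s t : algaut A.
Hypothesis stK : cancel s t.

(** Any pair with t s = id is allowed, so that one construction covers both Sigma^-1 Sigma and Sigma
    Sigma^-1. *)
Definition shift2 M : rhom M (tens (tens M (twist s)) (twist t)).
Proof.
exists (tone t _ \o tone s M)%VF => a x.
by rewrite !comp_lfunE !tone_ract stK.
Defined.

Lemma shift2E M x : shift2 M x = tone t _ (tone s M x).
Proof. by rewrite /= comp_lfunE. Qed.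

Lemma shift2_iso M : is_riso (shift2 M).
Proof.
apply: bij_riso.
  apply/injlP => x; rewrite shift2E => /((injlP _).1 (tone_inj t _)).
  exact: ((injlP _).1 (tone_inj s _)).
apply/surjlP => z; have [y ->] := (surjlP _).1 (tone_surj t _) z.
have [x ->] := (surjlP _).1 (tone_surj s _) y.
by exists x; rewrite shift2E.
Qed.

Definition unshift2 M : rhom (tens (tens M (twist s)) (twist t)) M.
Proof.
exists ((shift2 M)^-1)%VF => a x.
have sK y : ((shift2 M)^-1)%VF (shift2 M y) = y.
  by apply: injl_lfunK; apply/riso_inj/shift2_iso.
have [y ->] := (surjlP _).1 (riso_surj (shift2_iso M)) x.
by rewrite -rhomP !sK.
Defined.

Lemma shift2K M x : unshift2 M (shift2 M x) = x.
Proof. by apply: injl_lfunK; apply/riso_inj/shift2_iso. Qed.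

Lemma unshift2K M x : shift2 M (unshift2 M x) = x.
Proof. by apply: surjl_lfunVK; apply/riso_surj/shift2_iso. Qed.

Lemma unshift2_iso M : is_riso (unshift2 M).
Proof.
by apply/is_risoP; exists (shift2 M); split=> x; rewrite (shift2K, unshift2K).
Qed.

End Unit.

Lemma autK s : cancel s (aut_inv s).
Proof. exact: (lker0_lfunK (aut_inj s)). Qed.

Lemma autVK s : cancel (aut_inv s) s.
Proof. exact: (lker0_lfunVK (aut_inj s)). Qed.

End Shift.

(** * Bimodules B (x)_k N, and injectivity of bimodules as right modules *)

Section Outer.
Variables (k : fieldType) (A : falgType k).
Implicit Types (B : bimod A) (N : rmod A).

Lemma ktmap_id (V W : vectType k) : ktmap \1%VF \1%VF = \1%VF :> 'End(ktens V W).
Proof. by apply: kt_ext => v w; rewrite ktmapE !id_lfunE. Qed.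

Lemma outer_ract_linear B N :
  linear (fun a => ktmap \1%VF (ract N a) : 'End(ktens B N)).
Proof.
move=> c a b; apply: kt_ext => v w; rewrite add_lfunE scale_lfunE !ktmapE.
by rewrite linearP add_lfunE scale_lfunE; apply: kpureDr.
Qed.

Lemma outer_lact_linear B N :
  linear (fun a => ktmap (lact B a) \1%VF : 'End(ktens B N)).
Proof.
move=> c a b; apply: kt_ext => v w; rewrite add_lfunE scale_lfunE !ktmapE.
by rewrite linearP add_lfunE scale_lfunE; apply: kpureDl.
Qed.

Definition outer_ract B N : 'Hom(A, 'End(ktens B N)) :=
  linfun (fun a => ktmap \1%VF (ract N a)).
Definition outer_lact B N : 'Hom(A, 'End(ktens B N)) :=
  linfun (fun a => ktmap (lact B a) \1%VF).

Lemma outer_ract1 B N : outer_ract B N 1 = \1%VF.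
Proof. by rewrite /outer_ract (linfunE (@outer_ract_linear B N)) ract1 ktmap_id. Qed.

Lemma outer_ractM B N a b :
  outer_ract B N (a * b) = (outer_ract B N b \o outer_ract B N a)%VF.
Proof.
rewrite /outer_ract !(linfunE (@outer_ract_linear B N)); apply: kt_ext => v w.
by rewrite comp_lfunE !ktmapE ractM comp_lfunE !id_lfunE.
Qed.

Definition outer_rmod B N : rmod A := RMod (@outer_ract1 B N) (@outer_ractM B N).

Lemma outer_lact1 B N : outer_lact B N 1 = \1%VF.
Proof. by rewrite /outer_lact (linfunE (@outer_lact_linear B N)) lact1 ktmap_id. Qed.

Lemma outer_lactM B N a b :
  outer_lact B N (a * b) = (outer_lact B N a \o outer_lact B N b)%VF.
Proof.
rewrite /outer_lact !(linfunE (@outer_lact_linear B N)); apply: kt_ext => v w.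
by rewrite comp_lfunE !ktmapE lactM comp_lfunE !id_lfunE.
Qed.

Lemma outer_lractC B N a b : (outer_lact B N a \o ract (outer_rmod B N) b
  = ract (outer_rmod B N) b \o outer_lact B N a)%VF.
Proof.
rewrite /= /outer_lact /outer_ract (linfunE (@outer_lact_linear B N)).
rewrite (linfunE (@outer_ract_linear B N)); apply: kt_ext => v w.
by rewrite !comp_lfunE !ktmapE !id_lfunE.
Qed.

(** B (x)_k N, with a.(x (x) y).b = a.x (x) y.b *)
Definition outer B N : bimod A :=
  @BiMod k A (outer_rmod B N) (outer_lact B N) (@outer_lact1 B N)
    (@outer_lactM B N) (@outer_lractC B N).

Lemma outer_ractE B N a : ract (outer B N) a = ktmap \1%VF (ract N a).
Proof. by rewrite /= /outer_ract (linfunE (@outer_ract_linear B N)). Qed.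

Lemma outer_lactE B N a : lact (outer B N) a = ktmap (lact B a) \1%VF.
Proof. by rewrite /= /outer_lact (linfunE (@outer_lact_linear B N)). Qed.

Lemma breg_lactE a (x : A) : lact (breg A) a x = a * x.
Proof. by rewrite [LHS]twist_lactE id_lfunE. Qed.

Lemma rreg_ractE a (x : A) : ract (rreg A) a x = x * a.
Proof. exact: (@twist_ractE _ _ \1%AF). Qed.

Lemma ktmap_inj (V V' W W' : vectType k) (f : 'Hom(V, V')) (g : 'Hom(W, W')) :
  injl f -> injl g -> injl (ktmap f g).
Proof.
move=> fI gI; apply/injlP => z.
move/(congr1 (ktmap (f^-1)%VF (g^-1)%VF)); rewrite linear0 => <-.
rewrite -comp_lfunE -[LHS](id_lfunE z); congr (fun_of_lfun _ _).
by apply: kt_ext => v w; rewrite comp_lfunE !ktmapE id_lfunE !injl_lfunK.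
Qed.

Definition rinjective (Q : rmod A) : Prop :=
  forall (M N : rmod A) (g : rhom M N) (f : rhom M Q), injl g ->
  exists h : rhom N Q, forall x, h (g x) = f x.

(** A right linear map M -> Q is the same as a map of bimodules A (x)_k M -> Q. *)
Lemma binjective_rinjective (Q : bimod A) : binjective Q -> rinjective Q.
Proof.
move=> Qinj M N g f gI.
pose b L (u : L -> Q) (a : A) (x : L) := lact Q a (u x).
have bl (u : M -> Q) x : linear ((b M u)^~ x).
  by move=> c a a'; rewrite /b linearP add_lfunE scale_lfunE.
have br a : linear (b M f a) by move=> c x y; rewrite /b !linearP.
pose F := ktlift (V := breg A) (b M f) : 'Hom(outer (breg A) M, Q).
have FE a x : F (kpure (V := breg A) a x) = lact Q a (f x) by rewrite [LHS]ktliftE.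
have FP a z : F (ract (outer (breg A) M) a z) = ract Q a (F z).
  rewrite -!comp_lfunE outer_ractE; congr (fun_of_lfun _ _).
  apply: kt_ext => c x; rewrite [LHS]comp_lfunE [RHS]comp_lfunE ktmapE !FE.
  by rewrite id_lfunE rhomP -!comp_lfunE lractC.
have FlP a z : F (lact (outer (breg A) M) a z) = lact Q a (F z).
  rewrite -!comp_lfunE outer_lactE; congr (fun_of_lfun _ _).
  apply: kt_ext => c x; rewrite [LHS]comp_lfunE [RHS]comp_lfunE ktmapE !FE.
  by rewrite id_lfunE breg_lactE lactM comp_lfunE.
pose G := ktmap \1%VF g : 'Hom(outer (breg A) M, outer (breg A) N).
have GP a z : G (ract (outer (breg A) M) a z) = ract (outer (breg A) N) a (G z).
  rewrite -!comp_lfunE !outer_ractE; congr (fun_of_lfun _ _).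
  apply: kt_ext => c x; rewrite [LHS]comp_lfunE [RHS]comp_lfunE !ktmapE !id_lfunE.
  by rewrite rhomP.
have GlP a z : G (lact (outer (breg A) M) a z) = lact (outer (breg A) N) a (G z).
  rewrite -!comp_lfunE !outer_lactE; congr (fun_of_lfun _ _).
  by apply: kt_ext => c x; rewrite [LHS]comp_lfunE [RHS]comp_lfunE !ktmapE !id_lfunE.
have GI : injl G.
  by apply: ktmap_inj => //; apply/injlP => x; rewrite id_lfunE.
pose F' : bhom (outer (breg A) M) Q := @BHom _ _ _ _ (@RHom _ _ _ _ F FP) FlP.
pose G' : bhom (outer (breg A) M) (outer (breg A) N) :=
  @BHom _ _ _ _ (@RHom _ _ _ _ G GP) GlP.
have [H HE] := Qinj _ _ G' F' GI.
have hL : linear (fun x : N => H (kpure (V := breg A) (1 : A) x)).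
  by move=> c x y; rewrite kpureDr linearP.
have hP a x : H (kpure (V := breg A) (1 : A) (ract N a x))
    = ract Q a (H (kpure (V := breg A) (1 : A) x)).
  by rewrite -rhomP outer_ractE ktmapE id_lfunE.
exists (rhom_of hL hP) => x; rewrite rhom_ofE.
have -> : kpure (V := breg A) (1 : A) (g x) = G (kpure (V := breg A) (1 : A) x).
  by rewrite /G ktmapE id_lfunE.
by rewrite -[LHS](comp_lfunE H G') HE /= FE lact1 id_lfunE.
Qed.

End Outer.

(** * Exactness and projectivity of tensor products with projective bimodules *)

Section TensorExactness.
Variables (k : fieldType) (A : falgType k).
Implicit Types (B P Q : bimod A) (C M N : rmod A).

(** The splittings of theta respect only the left action, so they are linear maps with this property
    rather than maps of bimodules. *)
Definition leftlin B Q (u : 'Hom(B, Q)) :=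
  forall a x, u (lact B a x) = lact Q a (u x).

(** The action A (x)_k P -> P is a surjection of bimodules, hence splits: P is a summand of A (x)_k
    P, which is free as a left module. *)
Lemma bprojective_lsection P : bprojective P ->
  exists s : bhom P (outer (breg A) P),
    forall x, ktlift (V := breg A) (fun (a : A) x => lact P a x) (s x) = x.
Proof.
move=> Pproj; set m := ktlift _.
have mE a x : m (kpure (V := breg A) a x) = lact P a x.
  rewrite [LHS]ktliftE // => [x0|a0] c u v; last by rewrite linearP.
  by rewrite linearP add_lfunE scale_lfunE.
have mr a z : m (ract (outer (breg A) P) a z) = ract P a (m z).
  rewrite -!comp_lfunE outer_ractE; congr (fun_of_lfun _ _); apply: kt_ext => c x.
  by rewrite [LHS]comp_lfunE [RHS]comp_lfunE ktmapE !mE id_lfunE -!comp_lfunE lractC.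
have ml a z : m (lact (outer (breg A) P) a z) = lact P a (m z).
  rewrite -!comp_lfunE outer_lactE; congr (fun_of_lfun _ _); apply: kt_ext => c x.
  rewrite [LHS]comp_lfunE [RHS]comp_lfunE ktmapE !mE id_lfunE breg_lactE.
  by rewrite lactM comp_lfunE.
have mS : surjl m.
  apply/surjlP => x; exists (kpure (V := breg A) (1 : A) x).
  by rewrite mE lact1 id_lfunE.
pose m' := @BHom _ _ (outer (breg A) P) P (@RHom _ _ (outer (breg A) P) P m mr) ml.
have [s sE] := Pproj _ _ m' (bid P) mS; exists s => x.
by rewrite -(comp_lfunE m) sE id_lfunE.
Qed.

(** The mirror image: P is a summand of P (x)_k A, which is free as a right module. *)
Lemma bprojective_rsection P : bprojective P ->
  exists s : bhom P (outer P (rreg A)),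
    forall x, ktlift (W := rreg A) (fun x (a : A) => ract P a x) (s x) = x.
Proof.
move=> Pproj; set m := ktlift _.
have mE x a : m (kpure (W := rreg A) x a) = ract P a x.
  rewrite [LHS]ktliftE // => [x0|a0] c u v; first by rewrite linearP.
  by rewrite linearP add_lfunE scale_lfunE.
have mr a z : m (ract (outer P (rreg A)) a z) = ract P a (m z).
  rewrite -!comp_lfunE outer_ractE; congr (fun_of_lfun _ _); apply: kt_ext => x c.
  rewrite [LHS]comp_lfunE [RHS]comp_lfunE ktmapE !mE id_lfunE rreg_ractE.
  by rewrite ractM comp_lfunE.
have ml a z : m (lact (outer P (rreg A)) a z) = lact P a (m z).
  rewrite -!comp_lfunE outer_lactE; congr (fun_of_lfun _ _); apply: kt_ext => x c.
  by rewrite [LHS]comp_lfunE [RHS]comp_lfunE ktmapE !mE id_lfunE -!comp_lfunE lractC.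
have mS : surjl m.
  apply/surjlP => x; exists (kpure (W := rreg A) x (1 : A)).
  by rewrite mE ract1 id_lfunE.
pose m' := @BHom _ _ (outer P (rreg A)) P (@RHom _ _ (outer P (rreg A)) P m mr) ml.
have [s sE] := Pproj _ _ m' (bid P) mS; exists s => x.
by rewrite -(comp_lfunE m) sE id_lfunE.
Qed.

(** A k-linear lift [w] of u becomes left linear on A (x)_k P by a (x) x |-> a.w(x). Restricted
    along the section of P it is still a lift of u, since u and f are left linear. *)
Lemma leftlin_lift P B Q (f : bhom B Q) (u : 'Hom(P, Q)) :
  bprojective P -> leftlin u -> (limg u <= limg f)%VS ->
  exists2 e : 'Hom(P, B), leftlin e & forall x, f (e x) = u x.
Proof.
move=> /bprojective_lsection[s sE] uL /limg_sub_lift fw.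
set w := (f^-1 \o u)%VF in fw.
pose e0 := ktlift (V := breg A) (fun (a : A) x => lact B a (w x)).
have e0E a x : e0 (kpure (V := breg A) a x) = lact B a (w x).
  rewrite [LHS]ktliftE // => [x0|a0] c v v'; last by rewrite !linearP.
  by rewrite linearP add_lfunE scale_lfunE.
have e0L a z : e0 (lact (outer (breg A) P) a z) = lact B a (e0 z).
  rewrite outer_lactE -!comp_lfunE; congr (fun_of_lfun _ _); apply: kt_ext => c y.
  rewrite [LHS]comp_lfunE [RHS]comp_lfunE ktmapE !e0E id_lfunE breg_lactE.
  by rewrite lactM comp_lfunE.
exists (e0 \o s)%VF => [a x|x]; first by rewrite !comp_lfunE (bhomP s) e0L.
rewrite -[in RHS](sE x) comp_lfunE -(comp_lfunE f) -(comp_lfunE u).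
congr (fun_of_lfun _ _); apply: kt_ext => c y.
rewrite [LHS]comp_lfunE [RHS]comp_lfunE e0E bhomP -(comp_lfunE f) fw -uL.
congr (u _); rewrite [RHS]ktliftE // => [x0|a0] c' v v'; last by rewrite linearP.
by rewrite linearP add_lfunE scale_lfunE.
Qed.

(** C (x)_A P is a summand of (C (x)_A P) (x)_k A, so a k-linear lift [w] suffices: [K c] extends it
    by x (x) a |-> w(c (x) x).a, and the section of P brings the extension back. *)
Lemma tens_bprojective C P : bprojective P -> rprojective (tens C P).
Proof.
move=> /bprojective_rsection[s sE] M N g f gS.
set w := (g^-1 \o f)%VF.
have gw z : g (w z) = f z by rewrite -(comp_lfunE g) limg_sub_lift // (eqP gS) subvf.
pose K (c : C) := ktlift (W := rreg A) (fun x (a : A) => ract M a (w (tpure c x))).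
have KE c x a : K c (kpure (W := rreg A) x a) = ract M a (w (tpure c x)).
  rewrite [LHS]ktliftE // => [x0|a0] l u v; last first.
    by rewrite linearP add_lfunE scale_lfunE.
  by rewrite tpure_linearr !linearP.
have Kl : forall l c c', K (l *: c + c') = l *: K c + K c'.
  move=> l c c'; apply: kt_ext => x a.
  by rewrite add_lfunE scale_lfunE !KE tpure_linearl !linearP.
have KA a c z : K (ract C a c) z = K c (lact (outer P (rreg A)) a z).
  rewrite outer_lactE -(comp_lfunE (K c)); congr (fun_of_lfun _ _).
  apply: kt_ext => x b; rewrite comp_lfunE ktmapE !KE id_lfunE.
  by rewrite tpure_bal.
have KR a c z : K c (ract (outer P (rreg A)) a z) = ract M a (K c z).
  rewrite outer_ractE -!comp_lfunE; congr (fun_of_lfun _ _).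
  apply: kt_ext => x b; rewrite !comp_lfunE ktmapE !KE id_lfunE.
  by rewrite rreg_ractE ractM comp_lfunE.
pose e : 'Hom(tens C P, M) := tlift (fun c x => K c (s x)).
have eE c x : e (tpure c x) = K c (s x).
  rewrite [LHS]tliftE // => [y|c'|a c' y] ; last by rewrite bhomP KA.
    by move=> l u v; rewrite Kl add_lfunE scale_lfunE.
  by move=> l u v; rewrite !linearP.
have eP a z : e (ract (tens C P) a z) = ract M a (e z).
  rewrite -!comp_lfunE; congr (fun_of_lfun _ _); apply: t_ext => c x.
  by rewrite [LHS]comp_lfunE [RHS]comp_lfunE tens_ractE !eE rhomP KR.
exists (RHom eP); apply: t_ext => c x; rewrite comp_lfunE /= eE -[in RHS](sE x).
pose F : 'Hom(P, N) := linfun (fun x => f (tpure c x)).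
have FE y : F y = f (tpure c y).
  by rewrite /F linfunE // => l u v; rewrite tpure_linearr linearP.
rewrite -FE -[LHS](comp_lfunE g) -[RHS](comp_lfunE F).
congr (fun_of_lfun _ _); apply: kt_ext => y b.
rewrite !comp_lfunE KE FE rhomP gw -rhomP tens_ractE; congr (f (tpure _ _)).
rewrite [RHS]ktliftE // => [x0|a0] l u v; first by rewrite linearP.
by rewrite linearP add_lfunE scale_lfunE.
Qed.

Definition tlmap C B Q (u : 'Hom(B, Q)) : 'Hom(tens C B, tens C Q) :=
  qmap (balanced C B) (balanced C Q) (ktmap \1%VF u).

Lemma tlmapE C B Q (u : 'Hom(B, Q)) x y :
  leftlin u -> tlmap C u (tpure x y) = tpure x (u y).
Proof.
move=> uL; rewrite /tlmap /tpure qmapE ?ktmapE ?id_lfunE //.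
by apply: balanced_map => [b z|b z]; rewrite ?uL ?id_lfunE.
Qed.

Lemma tens_mor_ridE C B Q (f : bhom B Q) x y :
  tens_mor (rid C) f (tpure x y) = tpure x (f y).
Proof. by rewrite [LHS]tens_funE /= id_lfunE. Qed.

Lemma tens_surj M N B Q (f : rhom M N) (g : bhom B Q) :
  surjl f -> surjl g -> surjl (tens_mor f g).
Proof.
move=> fS gS; set h := tens_mor f g.
suff q0 : qpi (limg h) = 0.
  by rewrite /surjl eqEsubv subvf; apply/subvP => z _; rewrite -qpi_eq0 q0 zero_lfunE.
apply: t_ext => x y; rewrite zero_lfunE; apply/eqP; rewrite qpi_eq0.
have [x' ->] := (surjlP _).1 fS x; have [y' ->] := (surjlP _).1 gS y.
by apply/memv_imgP; exists (tpure x' y'); rewrite ?memvf // [RHS]tens_funE.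
Qed.

(** The role of a contracting homotopy of left modules: quasi-inverses survive
    C (x)_A - and hence preserve exactness. *)
Definition lqinv B Q (f : bhom B Q) :=
  exists2 e : 'Hom(Q, B), leftlin e & forall x, f (e (f x)) = f x.

(** The map 1 - e g takes P into ker g = im f, so it lifts along f to a left linear [e']; then f e'
    f = f - e g f = f. *)
Lemma lqinv_step B P Q (f : bhom B P) (g : bhom P Q) :
  bprojective P -> exact_at f g -> lqinv g -> lqinv f.
Proof.
move=> Pproj fg [e eL geg]; have [gf0 gf] := (exact_atP _ _).1 fg.
pose u := \1%VF - (e \o g)%VF.
have uE x : u x = x - e (g x).
  by rewrite add_lfunE opp_lfunE id_lfunE comp_lfunE.
have uL : leftlin u by move=> a x; rewrite !uE bhomP eL linearB.
have [|e' e'L fe'] := leftlin_lift (f := f) Pproj uL.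
  apply/subvP => _ /memv_imgP[x _ ->]; rewrite (eqP fg) memv_ker uE.
  by rewrite linearB /= geg subrr.
by exists e' => // x; rewrite fe' uE gf0 linear0 subr0.
Qed.

(** A is free on 1 as a left module, so a preimage [u] of 1 gives the section a |-> a.u. *)
Lemma lqinv_aug P (p : bhom P (breg A)) : surjl p -> lqinv p.
Proof.
move=> pS; have [u uE] := (surjlP _).1 pS (1 : A).
pose e : 'Hom(breg A, P) := linfun (fun a : A => lact P a u).
have eE (a : A) : e a = lact P a u.
  by rewrite /e linfunE // => l x y; rewrite linearP add_lfunE scale_lfunE.
exists e => [a x|x]; first by rewrite breg_lactE !eE lactM comp_lfunE.
by rewrite eE bhomP -uE breg_lactE mulr1.
Qed.

Lemma tens_inj_lqinv C B Q (f : bhom B Q) :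
  injl f -> lqinv f -> injl (tens_mor (rid C) f).
Proof.
move=> fI [e eL fef]; apply/injlP => z.
have ef x : e (f x) = x.
  apply/eqP; rewrite -subr_eq0; apply/eqP/((injlP _).1 fI).
  by rewrite linearB /= fef subrr.
move/(congr1 (tlmap C e)); rewrite linear0 => <-.
rewrite -comp_lfunE -[LHS](id_lfunE z); congr (fun_of_lfun _ _); apply: t_ext => x y.
by rewrite comp_lfunE id_lfunE tens_mor_ridE tlmapE // ef.
Qed.

Lemma tens_exact_lqinv C B P Q (f : bhom B P) (g : bhom P Q) :
  exact_at f g -> lqinv f -> lqinv g ->
  exact_at (tens_mor (rid C) f) (tens_mor (rid C) g).
Proof.
move=> /exact_atP[gf0 gf] [e eL fef] [e' e'L ge'g]; apply/exact_atP; split=> z.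
  suff E : (tens_mor (rid C) g \o tens_mor (rid C) f)%VF = 0.
    by rewrite -comp_lfunE E zero_lfunE.
  apply: t_ext => x y; rewrite comp_lfunE zero_lfunE !tens_mor_ridE gf0.
  by rewrite -(linfunE (@tpure_linearr _ _ C Q x)) linear0.
(* At P the maps [v] and [e'] form a contracting homotopy, y = f (v y) + e' (g y). Both are left
   linear, so the identity persists after tensoring with C. *)
pose v := (e \o (\1%VF - (e' \o g)))%VF.
have vE x : v x = e (x - e' (g x)).
  by rewrite !comp_lfunE add_lfunE opp_lfunE id_lfunE comp_lfunE.
have vL : leftlin v by move=> a x; rewrite !vE bhomP e'L -linearB eL.
have splitE y : y = f (v y) + e' (g y).
  have [|x xE] := gf (y - e' (g y)); first by rewrite linearB /= ge'g subrr.
  by rewrite vE xE fef -xE subrK.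
have zE : z = tens_mor (rid C) f (tlmap C v z) + tlmap C e' (tens_mor (rid C) g z).
  rewrite -[RHS]/(_ + _) -!comp_lfunE -add_lfunE -[LHS](id_lfunE z).
  congr (fun_of_lfun _ _); apply: t_ext => x y.
  rewrite id_lfunE add_lfunE [X in _ = X + _]comp_lfunE [X in _ = _ + X]comp_lfunE.
  rewrite tlmapE // !tens_mor_ridE tlmapE //.
  rewrite {1}(splitE y) -!(linfunE (@tpure_linearr _ _ C P x)).
  by rewrite linearD.
by move=> gz0; exists (tlmap C v z); rewrite {1}zE gz0 linear0 addr0.
Qed.

(** Preimages under g are unique up to im f, which dies modulo im F. A k-linear section of g
    therefore induces a well defined map [r] from C (x) B to the cokernel of F, and r G is the
    projection onto that cokernel. *)
Lemma tens_right_exact M N C B (f : rhom M N) (g : rhom N C) :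
  surjl g -> exact_at f g -> exact_at (tens_mor f (bid B)) (tens_mor g (bid B)).
Proof.
move=> gS /exact_atP[gf0 gf].
have TE L L' (h : rhom L L') x y : tens_mor h (bid B) (tpure x y) = tpure (h x) y.
  by rewrite [LHS]tens_funE /= id_lfunE.
set F := tens_mor f _; set G := tens_mor g _.
apply/exact_atP; split=> z.
  suff E : (G \o F)%VF = 0 by rewrite -comp_lfunE E zero_lfunE.
  apply: t_ext => x y; rewrite comp_lfunE zero_lfunE /F /G !TE gf0.
  by rewrite -(linfunE (@tpure_linearl _ _ C B y)) linear0.
pose q := qpi (limg F).
have qF x y : q (tpure (f x) y) = 0.
  by apply/eqP; rewrite qpi_eq0 -TE memv_img ?memvf.
have qg x x' y : g x = g x' -> q (tpure x y) = q (tpure x' y).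
  move=> gxx; have [|u uE] := gf (x - x'); first by rewrite linearB /= gxx subrr.
  apply/eqP; rewrite -subr_eq0 -linearB /=.
  rewrite -!(linfunE (@tpure_linearl _ _ N B y)) -linearB /= uE.
  by rewrite (linfunE (@tpure_linearl _ _ N B y)) qF.
have gV x : g ((g^-1)%VF x) = x by apply: surjl_lfunVK.
pose r := tlift (fun (x : C) (y : B) => q (tpure ((g^-1)%VF x) y)).
have rE x y : r (tpure x y) = q (tpure ((g^-1)%VF x) y).
  rewrite [LHS]tliftE // => [y'|x'|a x' y'].
  - by move=> l u v; rewrite linearP tpure_linearl linearP.
  - by move=> l u v; rewrite tpure_linearr linearP.
  - by rewrite -tpure_bal; apply: qg; rewrite gV rhomP gV.
have rG : (r \o G = q)%VF.
  by apply: t_ext => x y; rewrite comp_lfunE /G TE rE; apply: qg; rewrite gV.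
move=> Gz; have : q z = 0 by rewrite -rG comp_lfunE Gz linear0.
by move/eqP; rewrite qpi_eq0 => /memv_imgP[x _ ->]; exists x.
Qed.

(** As P is a summand of A (x)_k P, the map [kap] embeds M (x)_A P naturally into M (x)_A A (x)_k P
    = M (x)_k P, and tensoring over the field k preserves injectivity. *)
Lemma tens_inj_bprojective M N P (f : rhom M N) :
  bprojective P -> injl f -> injl (tens_mor f (bid P)).
Proof.
move=> /bprojective_lsection[s sE] fI.
have TE x y : tens_mor f (bid P) (tpure x y) = tpure (f x) y.
  by rewrite [LHS]tens_funE /= id_lfunE.
pose K (L : rmod A) (x : L) := ktlift (V := breg A) (N := ktens L P)
  (fun (a : A) (y : P) => kpure (ract L a x) y).
have KE (L : rmod A) (x : L) a y : K L x (kpure (V := breg A) a y) = kpure (ract L a x) y.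
  rewrite [LHS]ktliftE // => [y0|a0] l u v; last by rewrite kpureDr.
  by rewrite linearP add_lfunE scale_lfunE kpureDl.
pose kap (L : rmod A) : 'Hom(tens L P, ktens L P) := tlift (fun x y => K L x (s y)).
have kapE (L : rmod A) (x : L) y : kap L (tpure x y) = K L x (s y).
  rewrite [LHS]tliftE // => [y0|x0|a x0 y0].
  - move=> l u v; rewrite -scale_lfunE -add_lfunE; congr (fun_of_lfun _ _).
    apply: kt_ext => c z; rewrite add_lfunE scale_lfunE !KE.
    by rewrite linearP kpureDl.
  - by move=> l u v; rewrite !linearP.
  - rewrite bhomP outer_lactE -(comp_lfunE (K L x0)); congr (fun_of_lfun _ _).
    apply: kt_ext => c z; rewrite comp_lfunE ktmapE !KE id_lfunE breg_lactE.
    by rewrite ractM comp_lfunE.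
have qkap z : qpi (balanced M P) (kap M z) = z.
  rewrite -comp_lfunE -[RHS](id_lfunE z); congr (fun_of_lfun _ _).
  apply: t_ext => x y; rewrite comp_lfunE id_lfunE kapE -[in RHS](sE y).
  rewrite -(linfunE (@tpure_linearr _ _ M P x)) -[LHS]comp_lfunE.
  rewrite -[RHS](comp_lfunE (linfun _)).
  congr (fun_of_lfun _ _); apply: kt_ext => a u.
  rewrite [LHS]comp_lfunE [RHS]comp_lfunE KE (linfunE (@tpure_linearr _ _ M P x)).
  rewrite [ktlift _ _]ktliftE // => [|u0|a0]; first exact: tpure_bal.
    by move=> l v v'; rewrite linearP add_lfunE scale_lfunE.
  by move=> l v v'; rewrite linearP.
have nat z : kap N (tens_mor f (bid P) z) = ktmap f \1%VF (kap M z).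
  rewrite -!comp_lfunE; congr (fun_of_lfun _ _); apply: t_ext => x y.
  rewrite [LHS]comp_lfunE [RHS]comp_lfunE TE !kapE -comp_lfunE; congr (fun_of_lfun _ _).
  by apply: kt_ext => a u; rewrite comp_lfunE !KE ktmapE id_lfunE rhomP.
apply/injlP => z fz0; rewrite -(qkap z).
suff -> : kap M z = 0 by rewrite linear0.
have kI : injl (ktmap f (\1%VF : 'End(P))).
  by apply: ktmap_inj => //; apply/injlP => x; rewrite id_lfunE.
by apply: ((injlP _).1 kI); rewrite -nat fz0 linear0.
Qed.

Lemma tens_ses M N C P (f : rhom M N) (g : rhom N C) :
  bprojective P -> ses f g -> ses (tens_mor f (bid P)) (tens_mor g (bid P)).
Proof.
move=> Pproj [fI fg gS]; split; first exact: tens_inj_bprojective.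
  exact: tens_right_exact.
by apply: tens_surj => //; apply/surjlP => y; exists y; rewrite /= id_lfunE.
Qed.

End TensorExactness.

(** * Direct sums, and injectivity of projectives over a selfinjective algebra *)

Section ProjInj.
Variables (k : fieldType) (A : falgType k).
Implicit Types M N L Y : rmod A.

Lemma rreg_projective : rprojective (rreg A).
Proof.
move=> M N g f gS; have [m mE] := (surjlP _).1 gS (f (1 : A)).
have hL : linear (fun a : A => ract M a m).
  by move=> c a b; rewrite linearP add_lfunE scale_lfunE.
have hP a (x : rreg A) : ract M (ract (rreg A) a x : A) m = ract M a (ract M x m).
  by rewrite rreg_ractE ractM comp_lfunE.
exists (rhom_of (M := rreg A) hL hP); apply/lfunP => a.
rewrite comp_lfunE [X in g X](rhom_ofE (M := rreg A) hL hP) rhomP -mE -rhomP rreg_ractE.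
by rewrite mul1r.
Qed.

Lemma rprojective_lift Y M N (g : rhom M N) (f : rhom Y N) :
  rprojective Y -> surjl g -> exists h : rhom Y M, forall x, g (h x) = f x.
Proof.
by move=> Yp gS; have [h hE] := Yp _ _ g f gS; exists h => x; rewrite -hE comp_lfunE.
Qed.

Lemma rprojective_section Y M (g : rhom M Y) :
  rprojective Y -> surjl g -> exists h : rhom Y M, forall x, g (h x) = x.
Proof.
move=> Yp /(rprojective_lift (rid Y) Yp)[h hE]; exists h => x.
by rewrite hE id_lfunE.
Qed.

Lemma rinjective_retract Y M (g : rhom M Y) (h : rhom Y M) :
  (forall x, g (h x) = x) -> rinjective M -> rinjective Y.
Proof.
move=> gh Minj L N i f iI; have [u uE] := Minj _ _ i (rcomp h f) iI.
by exists (rcomp g u) => x; rewrite rcompE uE rcompE gh.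
Qed.

Section Sum.
Variables M N : rmod A.
Definition rfst : rhom (rsum M N) M.
Proof.
refine (@rhom_of _ _ (rsum M N) M (fun p : M * N => p.1) _ _).
  by move=> c p q.
by move=> a p; rewrite rsum_actE.
Defined.
Definition rsnd : rhom (rsum M N) N.
Proof.
refine (@rhom_of _ _ (rsum M N) N (fun p : M * N => p.2) _ _).
  by move=> c p q.
by move=> a p; rewrite rsum_actE.
Defined.
Lemma rfstE p : rfst p = p.1. Proof. exact: rhom_ofE. Qed.
Lemma rsndE p : rsnd p = p.2. Proof. exact: rhom_ofE. Qed.

Definition rpair L (f : rhom L M) (g : rhom L N) : rhom L (rsum M N).
Proof.
refine (@rhom_of _ _ L (rsum M N) (fun x => (f x, g x)) _ _).
  by move=> c p q; rewrite !linearP.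
by move=> a p; rewrite rsum_actE !rhomP.
Defined.
Lemma rpairE L (f : rhom L M) (g : rhom L N) x : rpair f g x = (f x, g x).
Proof. exact: (@rhom_ofE _ _ L (rsum M N)). Qed.

Definition rcopair L (f : rhom M L) (g : rhom N L) : rhom (rsum M N) L.
Proof.
refine (@rhom_of _ _ (rsum M N) L (fun p : M * N => f p.1 + g p.2) _ _).
  by move=> c p q /=; rewrite !linearP scalerDr addrACA.
by move=> a p; rewrite rsum_actE /= !rhomP linearD.
Defined.
Lemma rcopairE L (f : rhom M L) (g : rhom N L) p : rcopair f g p = f p.1 + g p.2.
Proof. exact: (@rhom_ofE _ _ (rsum M N)). Qed.

Lemma rinjective_sum : rinjective M -> rinjective N -> rinjective (rsum M N).
Proof.
move=> Mi Ni L L' g f gI.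
have [u uE] := Mi _ _ g (rcomp rfst f) gI.
have [v vE] := Ni _ _ g (rcomp rsnd f) gI.
exists (rpair u v) => x; rewrite rpairE uE vE !rcompE rfstE rsndE.
by case: (f x).
Qed.
End Sum.

Lemma rsum_morE M N M' N' (f : rhom M M') (g : rhom N N') p :
  rsum_mor f g p = (f p.1, g p.2).
Proof. exact: rsum_mor_funE. Qed.

(** F is a finite sum of copies of A. For a basis of a projective module Y, this exhibits Y as a
    summand of an injective module. *)
Lemma injective_cover Y (ys : seq Y) : rinjective (rreg A) ->
  exists (F : rmod A) (h : rhom F Y), rinjective F /\ {subset ys <= limg h}.
Proof.
move=> Ai; elim: ys => [|y ys [F [h [Fi hs]]]]; first by exists (rreg A), (rzero_hom _ _).
have uL : linear (fun a : A => ract Y a y).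
  by move=> c a b; rewrite linearP add_lfunE scale_lfunE.
have uP a (x : rreg A) : ract Y (ract (rreg A) a x : A) y = ract Y a (ract Y x y).
  by rewrite rreg_ractE ractM comp_lfunE.
pose u := rhom_of (M := rreg A) uL uP.
exists (rsum (rreg A) F), (rcopair u h); split; first exact: rinjective_sum.
move=> z; rewrite inE => /orP[/eqP ->|/hs/memv_imgP[x _ ->]]; apply/memv_imgP.
  exists ((1 : A, 0) : rsum (rreg A) F); rewrite ?memvf // rcopairE linear0 addr0.
  by rewrite [RHS](rhom_ofE (M := rreg A) uL uP) ract1 id_lfunE.
by exists ((0, x) : rsum (rreg A) F); rewrite ?memvf // rcopairE linear0 add0r.
Qed.

Lemma rprojective_rinjective Y :
  rinjective (rreg A) -> rprojective Y -> rinjective Y.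
Proof.
move=> Ai Yp; have [F [h [Fi hs]]] := injective_cover (vbasis {:Y}) Ai.
have hS : surjl h.
  rewrite /surjl eqEsubv subvf -(span_basis (vbasisP {:Y})).
  by apply/span_subvP => y /hs.
have [g gE] := rprojective_section Yp hS.
exact: (rinjective_retract gE Fi).
Qed.

Definition rzero : rmod A.
Proof.
exists ('rV[k]_0 : vectType k) 0.
- by apply/lfunP => x; rewrite [LHS]thinmx0 [RHS]thinmx0.
- by move=> a b; apply/lfunP => x; rewrite [LHS]thinmx0 [RHS]thinmx0.
Defined.

Lemma rzeroE (x : rzero) : x = 0.
Proof. by rewrite [LHS]thinmx0 [RHS]thinmx0. Qed.

Lemma rzero_projective : rprojective rzero.
Proof.
move=> M N g f _; exists (rzero_hom _ _); apply/lfunP => x.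
by rewrite (rzeroE x) !linear0.
Qed.

Definition pzero : projmod A := ProjMod rzero_projective.

End ProjInj.

(** * The sequence theta: selfinjectivity of A and exactness of C (x) theta *)

Section Theta.
Variables (k : fieldType) (A : falgType k) (d : nat) (s : algaut A).
Variable th : bext d (twist (aut_inv s)) (breg A).
Hypothesis thP : periodicity_seq th.

Lemma belast_bprojective : bprojective (Defs.belast th).
Proof. by case: thP => _ _ []. Qed.

Lemma bemid_bprojective i : (i <= d)%N -> bprojective (bemid th i).
Proof. by case: thP => _ + _ => /(_ i) H /H[]. Qed.

(** The map P_0 -> A splits over right modules since A is projective. So A is a summand of P_0,
    which is injective as a bimodule and therefore as a right module. *)
Lemma periodic_rinjective (Y : rmod A) : rprojective Y -> rinjective Y.
Proof.
apply: rprojective_rinjective; have [[_ _ _ _ eS] _ [_ Pi]] := thP.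
have [h hE] := rprojective_section (M := Defs.belast th) (g := beaug th)
  (@rreg_projective k A) eS.
exact: rinjective_retract hE (binjective_rinjective Pi).
Qed.

Lemma bext_lqinv :
  [/\ lqinv (beinc th), forall i, (i < d)%N -> lqinv (bedif th i),
      lqinv (bedl th) & lqinv (beaug th)].
Proof.
have [[eI eE eL eA eS] _ _] := thP.
(* [lqin i] speaks of the arrow that ends in the i-th middle term; for i = 0 this is the
   inclusion. *)
pose lqin i : Prop := match i with 0 => lqinv (beinc th) | j.+1 => lqinv (bedif th j) end.
have lqin_step i Q (g : bhom (bemid th i) Q) : (i <= d)%N ->
    eimg (bext_right th) i = lker g -> lqinv g -> lqin i.
  move=> /bemid_bprojective; case: i g => [|i] g Pp /eqP e gq;
  exact: lqinv_step Pp e gq.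
have qA : lqinv (beaug th) by apply: lqinv_aug.
have qL : lqinv (bedl th) by apply: lqinv_step belast_bprojective eA qA.
(* Quasi-inverses propagate from the augmentation towards the inclusion, so the induction runs
   downwards from d. *)
have qi j : (j <= d)%N -> lqin (d - j)%N.
  elim: j => [|j IH] jd; first by rewrite subn0; apply: lqin_step eL qL.
  have jd' : (d - j.+1 < d)%N by lia.
  apply: (lqin_step _ _ (bedif th (d - j.+1))); [lia|exact: eE|].
  by have := IH (ltnW jd); have -> : (d - j = (d - j.+1).+1)%N by lia.
split=> // [|i id]; first by have := qi d (leqnn _); rewrite subnn.
have := qi (d - i.+1)%N; have -> : (d - (d - i.+1) = i.+1)%N by lia.
by apply; lia.
Qed.

Lemma unitor_iso (C : rmod A) : is_riso (unitor C).
Proof.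
have i1 a : (\1%AF : 'AEnd(A)) a = a by rewrite id_lfunE.
have uE x (a : A) : unitor C (tpure (B := breg A) x a) = ract C a x.
  exact: unitor_funE.
apply: bij_riso; apply/injlP || apply/surjlP; last first.
  by move=> y; exists (tpure (B := breg A) y (1 : A)); rewrite uE ract1 id_lfunE.
move=> z uz; have : linfun (fun x : C => tpure (B := breg A) x (1 : A)) (unitor C z) = z.
  rewrite -comp_lfunE -[RHS](id_lfunE z); congr (fun_of_lfun _ _).
  apply: t_ext => x a; rewrite [LHS]comp_lfunE id_lfunE uE.
  rewrite (linfunE (@tpure_linearl _ _ C (breg A) (1 : A))) tpure_bal.
  by rewrite breg_lactE mulr1.
by rewrite uz linear0.
Qed.

Lemma tens_ext_exact (C : rmod A) : ext_exact (tens_ext th C).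
Proof.
have [[eI eE eL eA eS] _ _] := thP.
have [qI qi qL qA] := bext_lqinv.
have uI := (injlP _).1 (riso_inj (unitor_iso C)).
split.
- exact: tens_inj_lqinv.
- move=> i id; apply/eqP; case: i id (eE i id) => [|i] id /eqP e.
    exact: tens_exact_lqinv e qI (qi _ id).
  exact: tens_exact_lqinv e (qi _ (ltnW id)) (qi _ id).
- apply/eqP; move: eL qL; case: (d) th qI qi => [|n] th' qI' qi' /eqP e qL'.
    exact: tens_exact_lqinv e qI' qL'.
  exact: tens_exact_lqinv e (qi' _ (leqnn _)) qL'.
- have /exact_atP[e0 e1] := tens_exact_lqinv C eA qL qA.
  apply/exact_atP; split=> z; first by rewrite rcompE e0 linear0.
  by rewrite rcompE => /uI; apply: e1.
- apply/surjlP => y; have [z ->] := (surjlP _).1 (riso_surj (unitor_iso C)) y.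
  have rS : surjl (rid C) by apply/riso_surj/riso_id.
  have [w ->] := (surjlP _).1 (tens_surj rS eS) z; exists w.
  by rewrite rcompE.
Qed.

End Theta.

(** * Construction of angles *)

Section AngleConstruction.
Variables (k : fieldType) (A : falgType k) (d : nat) (s : algaut A).
Variable th : bext d (twist (aut_inv s)) (breg A).
Hypothesis thP : periodicity_seq th.
Hypothesis d_gt0 : (0 < d)%N.
Implicit Type S : dseq d s.
Local Notation si := (aut_inv s).
Local Notation T C f := (tens_mor (rid C) f).

Lemma shift_unitE (X : rmod A) x : shift_unit s x = shift2 (autK s) X x.
Proof. by rewrite shift2E !toneE. Qed.

(** A single morphism to C (x) theta, the identity at both ends, gives the equivalence in Ext.
    Condition (C1) follows: Sigma^-1 p is onto, so [smor S 0] has the image of i; and i and [tone]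
    are injective, so Sigma x_0 has the kernel of p. *)
Lemma angle_intro S (C : rmod A) (p : rhom (pshift s (sob S 0)) C)
    (i : rhom (tens C (twist si)) (sob S 1))
    (h : forall j, rhom (sob S j.+1) (tens C (bemid th j)))
    (hl : rhom (pshift s (sob S 0)) (tens C (Defs.belast th))) :
  ext_exact (angle_ext p i) ->
  (forall x, smor S 0 x = i (shift_mor si p (shift2 (autK s) _ x))) ->
  (forall x, h 0 (i x) = T C (beinc th) x) ->
  (forall j x, (j < d)%N -> h j.+1 (smor S j.+1 x) = T C (bedif th j) (h j x)) ->
  (forall x, hl (slast S x) = T C (bedl th) (h d x)) ->
  (forall x, unitor C (T C (beaug th) (hl x)) = p x) ->
  angle th S.
Proof.
move=> Ex x0E h0 hj hlE pE; split; last first.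
  have [iI _ _ ex pS] := Ex.
  exists C, p; split=> //; exists i; split=> //.
    by move=> x; rewrite shift_unitE.
  apply: rst_step; split=> //; split; first exact: tens_ext_exact.
  exists h, hl; split.
  - by apply/lfunP => x; rewrite comp_lfunE; apply: h0.
  - by move=> j jd; apply/lfunP => x; rewrite comp_lfunE [RHS]comp_lfunE; apply: hj.
  - by apply/lfunP => x; rewrite comp_lfunE [RHS]comp_lfunE; apply: hlE.
  - by apply/lfunP => x; rewrite comp_lfunE; rewrite -pE [LHS]rcompE.
have [iI ei el /exact_atP[e0 e1] pS] := Ex.
have x0S : limg (smor S 0) = limg i.
  apply/vspaceP => y; apply/memv_imgP/memv_imgP => -[x _ ->].
    by rewrite x0E; eexists; last reflexivity; rewrite memvf.
  have [z ->] := (surjlP _).1 (shift_surj si pS) x.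
  have [w ->] := (surjlP _).1 (riso_surj (shift2_iso (autK s) _)) z.
  by exists w; rewrite ?memvf // x0E.
split.
- move=> [|j] jd; first by rewrite /exact_at x0S -(ei 0 d_gt0).
  exact/eqP/(ei _ jd).
- apply/eqP; move: el; case: (d) d_gt0 S p i {h hl Ex x0E h0 hj hlE pE iI ei e0 e1 pS x0S}.
    by [].
  by move=> n _ S p i; apply.
- have ker_p x : p (tone s _ x) = 0 <-> smor S 0 x = 0.
    rewrite x0E shift2E; split=> [px0|/((injlP _).1 iI)].
      by rewrite shift_morE px0 !linear0.
    by rewrite shift_morE => /((injlP _).1 (tone_inj si _)).
  apply/exact_atP; split=> [x|z].
    have [y yE] := (surjlP _).1 (tone_surj s _) (slast S x).
    rewrite yE shift_morE; have := e0 x.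
    by rewrite [slast S x]yE => /ker_p ->; rewrite linear0.
  have [y yE] := (surjlP _).1 (tone_surj s _) z.
  rewrite yE shift_morE => /((injlP _).1 (tone_inj s _)) /ker_p py.
  exact: e1.
Qed.


Lemma tens_ext_comp0 (C : rmod A) x : T C (bedif th 0) (T C (beinc th) x) = 0.
Proof.
have [_ e _ _ _] := tens_ext_exact thP C.
by apply/eqP; rewrite -memv_ker -(e 0 d_gt0) memv_img ?memvf.
Qed.

Definition left_trivial_seq_ob (X : projmod A) (j : nat) : projmod A :=
  if j is _.+2 then pzero A else X.

(** X = X -> 0 -> ... -> 0 -> Sigma_d X *)
Definition left_trivial_seq (X : projmod A) : dseq d s :=
  DSeq (sob := left_trivial_seq_ob X)
    (fun j => match j return rhom (left_trivial_seq_ob X j) (left_trivial_seq_ob X j.+1) with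
              | 0 => rid X | _.+1 => rzero_hom _ _ end)
    (rzero_hom _ _).

(** Here C = Sigma X and p is the identity. As Sigma X is projective, C (x) P_0 -> C has a section,
    which serves as the last comparison map; the first one is forced by [beinc], and the others
    vanish. *)
Lemma angle_left_trivial_seq X : angle th (left_trivial_seq X).
Proof.
have [_ _ _ _ eS] := tens_ext_exact thP (pshift s X).
have [hl hlE] := rprojective_section (@pmP _ _ (pshift s X)) eS.
pose h j := match j return
     rhom (sob (left_trivial_seq X) j.+1) (tens (pshift s X) (bemid th j)) with
   | 0 => rcomp (T (pshift s X) (beinc th)) (shift2 (autK s) X)
   | j'.+1 => rzero_hom _ _ end.
have h0 j x : (0 < j)%N -> h j x = 0 by case: j x => // j x _; rewrite zero_lfunE.
have ob0 j (x : left_trivial_seq_ob X j.+1) : (0 < j)%N -> x = 0.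
  by case: j x => // j x _; apply: rzeroE.
apply: (@angle_intro (left_trivial_seq X) (pshift s X) (rid _) (unshift2 (autK s) X) h hl).
- split; first exact/riso_inj/unshift2_iso.
  + move=> [|j] jd /=; last by apply/vspaceP => x; rewrite (@rzeroE _ A x) !mem0v.
    rewrite (eqP (riso_surj (unshift2_iso (autK s) X))).
    by apply/vspaceP => x; rewrite memvf memv_ker zero_lfunE eqxx.
  + by apply/vspaceP => x; rewrite (ob0 _ x d_gt0) !mem0v.
  + apply/exact_atP; split=> [x|y]; first by rewrite zero_lfunE linear0.
    by rewrite id_lfunE => ->; exists 0; rewrite linear0.
  + exact/riso_surj/riso_id.
- move=> x; have E : shift_mor si (rid (pshift s X)) (shift2 (autK s) X x)
      = shift2 (autK s) X x by rewrite shift2E shift_morE id_lfunE.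
  rewrite [RHS](congr1 (unshift2 (autK s) X) E).
  by rewrite [LHS]id_lfunE [RHS]shift2K.
- by move=> x; rewrite rcompE unshift2K.
- move=> [|j] x jd; first by rewrite rcompE tens_ext_comp0 zero_lfunE.
  by rewrite !zero_lfunE linear0.
- by move=> x; rewrite h0 // zero_lfunE !linear0.
- by move=> x; rewrite -rcompE hlE id_lfunE.
Qed.

Definition right_trivial_seq_ob (Y : projmod A) (j : nat) : projmod A :=
  match j with 1 | 2 => Y | _ => pzero A end.

(** 0 -> Y = Y -> 0 -> ... -> 0 *)
Definition right_trivial_seq (Y : projmod A) : dseq d s :=
  DSeq (sob := right_trivial_seq_ob Y)
    (fun j => match j return rhom (right_trivial_seq_ob Y j) (right_trivial_seq_ob Y j.+1) with
              | 1 => rid Y | _ => rzero_hom _ _ end)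
    (rzero_hom _ _).

Lemma shift_rzeroE (t : algaut A) (x : tens (rzero A) (twist t)) : x = 0.
Proof.
have [y ->] := (surjlP _).1 (tone_surj t _) x.
by rewrite (rzeroE y) linear0.
Qed.

Lemma angle_right_trivial_seq Y : angle th (right_trivial_seq Y).
Proof.
apply: (@angle_intro (right_trivial_seq Y) (rzero A) (rzero_hom _ _) (rzero_hom _ _)
  (fun j => rzero_hom _ _) (rzero_hom _ _)).
- split.
  + by apply/injlP => x _; apply: shift_rzeroE.
  + move=> [|[|j]] jd /=.
    * apply/vspaceP => x; rewrite memv_ker id_lfunE; apply/memv_imgP/eqP => [[y _]|->].
        by rewrite zero_lfunE.
      by exists 0; rewrite ?mem0v // linear0.
    * apply/vspaceP => x; rewrite memv_ker zero_lfunE eqxx.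
      by apply/memv_imgP; exists x; rewrite ?memvf // id_lfunE.
    * by apply/vspaceP => x; rewrite (@rzeroE _ A x) !mem0v.
  + apply/vspaceP => x; rewrite memv_ker zero_lfunE eqxx; set E := angle_ext _ _.
    suff full n (y : emid E n) : (0 < n)%N -> y \in eimg E n by apply: full.
    case: n y => // -[|n] y _ /=; last by rewrite (@rzeroE _ A y) mem0v.
    by apply/memv_imgP; exists y; rewrite ?memvf // id_lfunE.
  + apply/exact_atP; split=> [x|y]; first by rewrite zero_lfunE.
    by exists 0; rewrite linear0; apply: shift_rzeroE.
  + by apply/surjlP => y; exists 0; rewrite linear0 (rzeroE y).
- by move=> x; rewrite !zero_lfunE.
- by move=> x; rewrite (shift_rzeroE x) !linear0.
- by move=> j x jd; rewrite !zero_lfunE linear0.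
- by move=> x; rewrite !zero_lfunE linear0.
- by move=> x; rewrite [LHS](@rzeroE _ A) [RHS](@rzeroE _ A).
Qed.

(** The angle is C (x) theta with its end rewritten: C (x) P_0 must have the form Sigma X_0, so X_0
    = Sigma^-1 (C (x) P_0), and x_0 is dictated by (C2). The image of Sigma x_0 is C again, which
    brings the rank of C itself into the relations (RM2). *)
Lemma tensor_angle (C : rmod A) :
  exists (S : dseq d s) (p : rhom (pshift s (sob S 0)) C),
  [/\ angle th S, surjl p /\ exact_at (slast S) p, fac (shift_mor s (smor S 0)) C,
      forall j, (j <= d)%N -> risom (sob S j.+1) (tens C (bemid th j))
    & risom (pshift s (sob S 0)) (tens C (Defs.belast th))].
Proof.
(* For j > d the module C (x) bemid th j need not be projective, but it does not
   occur in the exact sequence. *)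
have pr j : {Z : projmod A & {t : rhom Z (tens C (bemid th j)) &
    {f : rhom (tens C (bemid th j)) Z | (j <= d)%N -> cancel t f /\ cancel f t}}}.
  case: (boolP (j <= d)%N) => jd; last first.
    by exists (pzero A), (rzero_hom _ _), (rzero_hom _ _).
  exists (ProjMod (tens_bprojective (C := C) (bemid_bprojective thP jd))), (rid _), (rid _).
  by split=> x; rewrite !id_lfunE.
pose Z j := projT1 (pr j); pose t j := projT1 (projT2 (pr j)).
pose f j := sval (projT2 (projT2 (pr j))).
have tK j (jd : (j <= d)%N) : cancel (t j) (f j) /\ cancel (f j) (t j).
  exact: (svalP (projT2 (projT2 (pr j)))).
have f0 j (jd : (j <= d)%N) y : f j y = 0 -> y = 0.
  by move/(congr1 (t j)); rewrite (tK j jd).2 linear0.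
have PN : rprojective (tens C (Defs.belast th)).
  exact/tens_bprojective/belast_bprojective.
pose N := ProjMod PN.
have [iI ei el /exact_atP[ea0 ea] pS] := tens_ext_exact thP C.
pose p := rcomp (rcomp (unitor C) (T C (beaug th))) (unshift2 (autVK s) N).
pose X0 := pshift si N.
pose i := rcomp (f 0) (T C (beinc th)).
pose x0 := rcomp (rcomp i (shift_mor si p)) (shift2 (autK s) X0).
pose ob j : projmod A := if j is j'.+1 then Z j' else X0.
pose S : dseq d s := DSeq (sob := ob)
  (fun j => match j return rhom (ob j) (ob j.+1) with 0 => x0
     | j'.+1 => rcomp (f j'.+1) (rcomp (T C (bedif th j')) (t j')) end)
  (rcomp (shift2 (autVK s) N) (rcomp (T C (bedl th)) (t d))).
have x0E x : x0 x = i (shift_mor si p (shift2 (autK s) X0 x)).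
  by rewrite [LHS]rcompE [LHS]rcompE.
have uS : surjl (unshift2 (autVK s) N) by apply/riso_surj/unshift2_iso.
have pS' : surjl p.
  apply/surjlP => z; have [y ->] := (surjlP _).1 pS z.
  by have [x ->] := (surjlP _).1 uS y; exists x; rewrite [RHS]rcompE.
have lp' : exact_at (slast S) p.
  apply/exact_atP; split=> [x|y].
    rewrite [slast S x]rcompE [LHS]rcompE shift2K.
    by rewrite [rcomp (T C (bedl th)) _ x]rcompE; apply: ea0.
  rewrite rcompE => /ea[x xE].
  have [x' x'E] : exists x', x = t d x' by exists (f d x); rewrite (tK d _).2.
  by exists x'; rewrite !rcompE -x'E -xE unshift2K.
have iI' : injl i.
  apply/injlP => x; rewrite rcompE => /(f0 0 (leq0n d)).
  exact: ((injlP _).1 iI).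
pose E := angle_ext (S := S) p i.
have imE j y : (j <= d)%N -> (y \in eimg E j) = (t j y \in eimg (tens_ext th C) j).
  case: j y => [|j] y jd; apply/memv_imgP/memv_imgP => -[x _ yE].
  - by exists x; rewrite ?memvf // yE rcompE (tK 0 jd).2.
  - by exists x; rewrite ?memvf // rcompE -yE (tK 0 jd).1.
  - by exists (t j x); rewrite ?memvf // yE rcompE (tK j.+1 jd).2 rcompE.
  - exists (f j x); rewrite ?memvf // rcompE rcompE (tK j (ltnW jd)).2 -yE.
    by rewrite (tK j.+1 jd).1.
have Eex : ext_exact E.
  split=> // [j jd|].
    apply/vspaceP => y; rewrite imE ?(ltnW jd) // ei // !memv_ker.
    rewrite [edif E j y]rcompE rcompE; apply/eqP/eqP => [->|]; first by rewrite linear0.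
    exact: f0.
  apply/vspaceP => y; rewrite imE // el !memv_ker.
  rewrite [edl E y]rcompE rcompE; apply/eqP/eqP => [->|]; first by rewrite linear0.
  by move/((injlP _).1 (riso_inj (shift2_iso (autVK s) N))).
exists S, p; split=> //.
- apply: (@angle_intro S C p i t (unshift2 (autVK s) N)) => //.
  + by move=> x; rewrite rcompE (tK 0 (leq0n d)).2.
  + by move=> j x jd; rewrite rcompE (tK j.+1 jd).2 rcompE.
  + by move=> x; rewrite rcompE shift2K rcompE.
  + by move=> x; rewrite !rcompE.
- exists p, (rcomp (shift_mor s i) (shift2 (autVK s) C)); split=> //.
    apply/injlP => x; rewrite rcompE => /((injlP _).1 (shift_inj s iI')).
    exact: ((injlP _).1 (riso_inj (shift2_iso (autVK s) C))).
  move=> z; have [x ->] := (surjlP _).1 (tone_surj s _) z.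
  rewrite [LHS](shift_morE s x0) x0E [RHS]rcompE.
  rewrite [shift2 (autVK s) C _]shift2E shift_morE.
  by rewrite [shift2 (autK s) X0 x]shift2E [shift_mor si p _]shift_morE.
- move=> j jd; exists (t j); apply/is_risoP; exists (f j).
  by case: (tK j jd).
- by exists (unshift2 (autVK s) N); apply: unshift2_iso.
Qed.

End AngleConstruction.

(** * Additive functions, images of morphisms, and shears *)

Section Additive.
Variables (k : fieldType) (A : falgType k) (R : zmodType).
Implicit Types (M N L X Y Z : rmod A) (phi : rmod A -> R).

Definition additive_fn phi :=
  forall M N L (i : rhom M N) (p : rhom N L), ses i p -> phi N = phi M + phi L.

Lemma additive_fn0 phi M : additive_fn phi -> (forall x : M, x = 0) -> phi M = 0.
Proof.
move=> phiD M0; apply: (addrI (phi M)); rewrite addr0.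
apply/esym/(phiD _ _ _ (rid M) (rid M)).
have ri := riso_id M; split; [exact: riso_inj|apply/exact_atP|exact: riso_surj].
by split=> [x|y _]; [exact: M0|exists y; rewrite id_lfunE].
Qed.

Lemma additive_fn_iso phi M N : additive_fn phi -> risom M N -> phi M = phi N.
Proof.
move=> phiD [f fi]; have := phiD _ _ _ f (rzero_hom N (rzero A)).
rewrite [phi (rzero A)]additive_fn0 ?addr0 //; last exact: rzeroE.
move=> -> //; split; first exact: riso_inj.
  apply/exact_atP; split=> [x|y _]; first by rewrite zero_lfunE.
  exact: (surjlP _).1 (riso_surj fi) y.
by apply/surjlP => y; exists 0; rewrite [y]rzeroE linear0.
Qed.

Lemma fac_risom X Y (f : rhom X Y) M N : fac f M -> fac f N -> risom M N.
Proof.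
move=> [p [i [pS iI fE]]] [p' [i' [p'S i'I fE']]].
have i0 := (injlP _).1 iI; have i'0 := (injlP _).1 i'I.
have pV x : p ((p^-1)%VF x) = x by apply: surjl_lfunVK.
pose g := (p' \o p^-1)%VF.
have gp x : g (p x) = p' x.
  apply/eqP; rewrite -subr_eq0; apply/eqP/i'0.
  by rewrite comp_lfunE linearB /= -!fE' !fE pV subrr.
have gP a x : g (ract M a x) = ract N a (g x).
  by have [y ->] := (surjlP _).1 pS x; rewrite -rhomP !gp rhomP.
exists (RHom gP); apply: bij_riso.
  apply/injlP => x; have [y ->] := (surjlP _).1 pS x; rewrite [_ (p y)]gp => p'y.
  by apply: i0; rewrite -fE fE' p'y linear0.
apply/surjlP => x; have [y ->] := (surjlP _).1 p'S x.
by exists (p y); rewrite [RHS]gp.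
Qed.

Lemma fac_iso X Y (f : rhom X Y) M N : fac f M -> risom M N -> fac f N.
Proof.
move=> [p [i [pS iI fE]]] [g gi]; have [h [gK hK]] := (is_risoP g).1 gi.
exists (rcomp g p), (rcomp i h); split.
- apply/surjlP => y; have [x xE] := (surjlP _).1 pS (h y).
  by exists x; rewrite rcompE -xE hK.
- apply/injlP => x; rewrite rcompE => /((injlP _).1 iI) hx.
  by rewrite -(hK x) hx linear0.
- by move=> x; rewrite rcompE rcompE gK fE.
Qed.

Lemma fac_limg X Y (f : rhom X Y) (U : {vspace Y}) (sU : stable U) :
  limg f = U -> fac f (rsub sU).
Proof.
move=> fU; have [|g gE] := rsub_corestr sU (f := f); first by rewrite fU.
exists g, (rincl sU); split=> //; last exact: rincl_inj.
apply/surjlP => y; have /memv_imgP[x _ yE] : vsval y \in limg f by rewrite fU subvsP.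
by exists x; apply: val_inj; rewrite /= yE -gE rinclE.
Qed.

Lemma fac_exact_ses X Y Z (f : rhom X Y) (g : rhom Y Z) M N :
  fac f M -> fac g N -> exact_at f g ->
  exists (i : rhom M Y) (p : rhom Y N), ses i p.
Proof.
move=> [p [i [pS iI fE]]] [p' [i' [p'S i'I gE]]] /exact_atP[gf0 gf].
exists i, p'; split=> //; apply/exact_atP; split=> [x|y p'y].
  have [z ->] := (surjlP _).1 pS x; apply: ((injlP _).1 i'I).
  by rewrite -gE -fE gf0.
have [|x ->] := gf y; first by rewrite gE p'y linear0.
by exists (p x).
Qed.

Lemma fac_sum X Y X' Y' (f : rhom X Y) (g : rhom X' Y') M N :
  fac f M -> fac g N -> fac (rsum_mor f g) (rsum M N).
Proof.
move=> [p [i [pS iI fE]]] [p' [i' [p'S i'I gE]]].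
exists (rsum_mor p p'), (rsum_mor i i'); split.
- apply/surjlP => -[y y']; have [x ->] := (surjlP _).1 pS y.
  by have [x' ->] := (surjlP _).1 p'S y'; exists (x, x'); rewrite rsum_morE.
- apply/injlP => -[x x']; rewrite rsum_morE => -[/((injlP _).1 iI) /= -> ].
  by move/((injlP _).1 i'I) => /= ->.
- by move=> -[x x']; rewrite rsum_morE rsum_morE [in RHS]rsum_morE /= fE gE.
Qed.

Lemma ses_sum M N : ses (rpair (rid M) (rzero_hom M N)) (rsnd M N).
Proof.
split.
- by apply/injlP => x; rewrite rpairE id_lfunE => -[].
- apply/exact_atP; split=> [x|[x y]]; first by rewrite rpairE rsndE /= zero_lfunE.
  move=> y0; have -> : y = 0 by move: y0; rewrite rsndE.
  by exists x; rewrite rpairE id_lfunE zero_lfunE.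
- by apply/surjlP => y; exists (0, y); rewrite rsndE.
Qed.

Lemma ses_split M N L (i : rhom M N) (p : rhom N L) :
  rprojective L -> ses i p -> risom (rsum M L) N.
Proof.
move=> Lp [iI /exact_atP[pi0 pi] pS]; have [q qK] := rprojective_section Lp pS.
exists (rcopair i q); apply: bij_riso.
  apply/injlP => -[x y]; rewrite rcopairE /= => e0.
  have y0 : y = 0 by rewrite -(qK y) -[p _]add0r -(pi0 x) -linearD /= e0 linear0.
  by move: e0; rewrite y0 linear0 addr0 => /((injlP _).1 iI) ->.
apply/surjlP => z; have [|x xE] := pi (z - q (p z)); first by rewrite linearB /= qK subrr.
by exists (x, p z); rewrite rcopairE /= -xE subrK.
Qed.

(** [psi] is the shear (x, x') |-> (x - h' x', x') followed by (x, x') |-> (x, x' + h x), where h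
    lifts p along p' and h' lifts p' along p. *)
Lemma shear_proj (X X' M : rmod A) (p : rhom X M) (p' : rhom X' M) :
  rprojective X -> rprojective X' -> surjl p -> surjl p' ->
  exists2 psi : rhom (rsum X X') (rsum X X'),
    is_riso psi & forall z, p' (psi z).2 = p z.1.
Proof.
move=> Xp X'p pS p'S.
have [h hE] := rprojective_lift p Xp p'S.
have [h' h'E] := rprojective_lift p' X'p pS.
pose a := rcopair (rid X) (ropp h').
pose b := rcopair (ropp h) (rid X').
have aE z : a z = z.1 - h' z.2 by rewrite rcopairE id_lfunE opp_lfunE.
have bE z : b z = z.2 - h z.1 by rewrite rcopairE id_lfunE opp_lfunE addrC.
pose psi := rpair a (radd (rsnd X X') (rcomp h a)).
pose inv := rpair (radd (rfst X X') (rcomp h' b)) b.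
have psiE z : psi z = (a z, z.2 + h (a z)).
  by rewrite rpairE add_lfunE rsndE comp_lfunE.
have invE z : inv z = (z.1 + h' (b z), b z).
  by rewrite rpairE add_lfunE rfstE comp_lfunE.
exists psi; last first.
  by move=> z; rewrite psiE /= linearD /= hE aE linearB /= h'E addrC subrK.
apply/is_risoP; exists inv; split=> -[x y].
  by rewrite invE bE psiE /= addrK aE /= subrK.
by rewrite psiE aE invE /= addrK bE /= subrK.
Qed.

(** Dual to [shear_proj]: h extends i' along i, and h' extends i along i'. *)
Lemma shear_inj (Y Y' M : rmod A) (i : rhom M Y) (i' : rhom M Y') :
  rinjective Y -> rinjective Y' -> injl i -> injl i' ->
  exists2 phi : rhom (rsum Y Y') (rsum Y Y'),
    is_riso phi & forall x, phi (i x, 0) = (0, i' x).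
Proof.
move=> Yi Y'i iI i'I.
have [h hE] := Y'i _ _ i i' iI; have [h' h'E] := Yi _ _ i' i i'I.
pose a := rcopair h (rid Y').
pose b := rcopair (rid Y) h'.
have aE z : a z = h z.1 + z.2 by rewrite rcopairE id_lfunE.
have bE z : b z = z.1 + h' z.2 by rewrite rcopairE id_lfunE.
pose phi := rpair (radd (rfst Y Y') (ropp (rcomp h' a))) a.
pose inv := rpair b (radd (rsnd Y Y') (ropp (rcomp h b))).
have phiE z : phi z = (z.1 - h' (a z), a z).
  by rewrite rpairE add_lfunE rfstE opp_lfunE comp_lfunE.
have invE z : inv z = (b z, z.2 - h (b z)).
  by rewrite rpairE add_lfunE rsndE opp_lfunE comp_lfunE.
exists phi; last first.
  by move=> x; rewrite phiE aE /= hE addr0 h'E subrr.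
apply/is_risoP; exists inv; split=> -[x y].
  by rewrite invE bE phiE /= subrK aE /= addrC addKr.
by rewrite phiE aE invE /= bE /= [h _ + _]addrC subrK addrK.
Qed.

End Additive.

(** * From a rank function to an additive function on modules *)

Section RankToAdditive.
Variables (k : fieldType) (A : falgType k) (d : nat) (s : algaut A).
Variable th : bext d (twist (aut_inv s)) (breg A).
Hypothesis thP : periodicity_seq th.
Hypothesis d_odd : odd d.
Variables (R : realType) (r : rankfn th R).
Implicit Types (X Y P : projmod A) (M N L C : rmod A).

Let d_gt0 : (0 < d)%N.
Proof. by case: (d) d_odd. Qed.

Lemma proj_inj Y : rinjective Y.
Proof. exact (periodic_rinjective thP (@pmP _ _ Y)). Qed.

(** Up to isomorphism the zero map X -> Y is the sum of X -> 0 and 0 -> Y. In the trivial angles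
    these maps stand next to an identity, so (RM2) makes both ranks zero. *)
Lemma rk_zero_mor X Y : rk r (rzero_hom X Y) = 0.
Proof.
have zl : rk r (rzero_hom X (pzero A)) = 0.
  have [e _] := rk_RM2 r (angle_left_trivial_seq thP d_gt0 X).
  by have := e 0 d_gt0; rewrite subrr add0r.
have zr : rk r (rzero_hom (pzero A) Y) = 0.
  have [e _] := rk_RM2 r (angle_right_trivial_seq thP d_gt0 Y).
  by have := e 0 d_gt0; rewrite subrK.
have := rk_RM1 r (rzero_hom X (pzero A)) (rzero_hom (pzero A) Y).
rewrite zl zr addr0 => <-.
pose psi : rhom X (psum X (pzero A)) := rpair (rid X) (rzero_hom _ _).
pose phi : rhom Y (psum (pzero A) Y) := rpair (rzero_hom _ _) (rid Y).
apply: (rk_RM0 r (psi := psi) (phi := phi)).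
- apply/is_risoP; exists (rfst X (pzero A)); split=> [x|[x y]].
    by rewrite rpairE rfstE id_lfunE.
  by rewrite rpairE rfstE id_lfunE zero_lfunE [y](@rzeroE _ A).
- apply/is_risoP; exists (rsnd (pzero A) Y); split=> [x|[x y]].
    by rewrite rpairE rsndE id_lfunE.
  by rewrite rpairE rsndE id_lfunE zero_lfunE [x](@rzeroE _ A).
- apply/lfunP => x; rewrite [LHS]comp_lfunE [RHS]comp_lfunE zero_lfunE linear0.
  by rewrite rpairE rsum_morE !zero_lfunE.
Qed.

Lemma rk_fac X Y X' Y' (f : rhom X Y) (g : rhom X' Y') M :
  fac f M -> fac g M -> rk r f = rk r g.
Proof.
move=> [p [i [pS iI fE]]] [p' [i' [p'S i'I gE]]].
rewrite -[LHS]addr0 -(rk_zero_mor X' Y') -[RHS]add0r -(rk_zero_mor X Y).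
have [psi psi_iso psiE] := shear_proj (@pmP _ _ X) (@pmP _ _ X') pS p'S.
have [phi phi_iso phiE] := shear_inj (@proj_inj Y) (@proj_inj Y') iI i'I.
rewrite -!rk_RM1; apply: (rk_RM0 r (X := psum X X') (Y := psum Y Y') (X' := psum X X')
  (Y' := psum Y Y') psi_iso phi_iso); apply/lfunP => z.
rewrite [LHS]comp_lfunE [RHS]comp_lfunE !rsum_morE !zero_lfunE fE phiE.
by rewrite gE psiE.
Qed.

Lemma fac_exists C : exists (X Y : projmod A) (f : rhom X Y), fac f C.
Proof.
have [S [p [_ _ fC _ _]]] := tensor_angle thP d_gt0 C.
by exists (pshift s (sob S 0)), (pshift s (sob S 1)), (shift_mor s (smor S 0)).
Qed.

Lemma rk_image_fun : exists n : rmod A -> R,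
  forall X Y (f : rhom X Y) M, fac f M -> rk r f = n M.
Proof.
have /choice[n nE] : forall M, exists v, exists (X Y : projmod A) (f : rhom X Y),
    fac f M /\ v = rk r f.
  by move=> M; have [X [Y [f fM]]] := fac_exists M; exists (rk r f), X, Y, f.
exists n => X Y f M fM; have [X' [Y' [g [gM ->]]]] := nE M.
exact: rk_fac fM gM.
Qed.

Variables (n : rmod A -> R).
Hypothesis nE : forall X Y (f : rhom X Y) M, fac f M -> rk r f = n M.

Lemma modrank_iso M N : risom M N -> n M = n N.
Proof.
have [X [Y [f fM]]] := fac_exists M.
by move=> /(fac_iso fM) /nE <-; rewrite -(nE fM).
Qed.

Lemma modrank_sum M N : n (rsum M N) = n M + n N.
Proof.
have [X [Y [f fM]]] := fac_exists M; have [X' [Y' [g gN]]] := fac_exists N.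
rewrite -(nE fM) -(nE gN) -rk_RM1.
exact/esym/(nE (X := psum X X') (Y := psum Y Y'))/fac_sum.
Qed.

Lemma modrank_proj X : n X = rk r (rid X).
Proof. exact/esym/nE/fac_surj/riso_surj/riso_id. Qed.

Lemma modrank_ses_proj M N L (i : rhom M N) (p : rhom N L) :
  rprojective L -> ses i p -> n N = n M + n L.
Proof. by move=> Lp /(ses_split Lp) /modrank_iso <-; rewrite modrank_sum. Qed.

(** In P (+) P' the kernel of (p, 0) is M (+) P' and that of (0, p') is P (+) M'. The automorphism
    [psi] carries the first kernel onto the second, so both are images of morphisms of projectives
    that differ by [psi]. *)
Lemma modrank_schanuel M M' L P P' (i : rhom M P) (p : rhom P L)
    (i' : rhom M' P') (p' : rhom P' L) :
  ses i p -> ses i' p' -> n M + n P' = n M' + n P.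
Proof.
move=> [iI /exact_atP[pi0 pi] pS] [i'I /exact_atP[pi'0 pi'] p'S].
have [X [_ [_ [q [_ [qS _ _]]]]]] := fac_exists M.
have [X' [_ [_ [q' [_ [q'S _ _]]]]]] := fac_exists M'.
have [psi psi_iso psiE] := shear_proj (@pmP _ _ P) (@pmP _ _ P') pS p'S.
pose f := rcomp i q; pose f' := rcomp i' q'.
have fM : fac f M by exists q, i; split=> // x; rewrite rcompE.
have f'M : fac f' M' by exists q', i'; split=> // x; rewrite rcompE.
have ridP (Q : projmod A) : fac (rid Q) Q by apply/fac_surj/riso_surj/riso_id.
rewrite -modrank_sum addrC -modrank_sum.
pose g : rhom (psum X P') (psum P P') := rcomp psi (rsum_mor f (rid P')).
pose g' : rhom (psum P X') (psum P P') := rsum_mor (rid P) f'.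
rewrite -(nE (X := psum X P') (Y := psum P P') (fac_sum fM (ridP P'))).
rewrite -(nE (fac_sum (ridP P) f'M : fac g' _)).
rewrite (nE (fac_rimg g')) -[RHS](nE (f := g)).
  apply: (rk_RM0 r (X := psum X P') (Y := psum P P') (Y' := psum P P')
    (riso_id _) psi_iso); apply/lfunP => z.
  by rewrite [LHS]comp_lfunE [RHS]comp_lfunE id_lfunE [RHS]rcompE.
apply: fac_limg; apply/vspaceP => z.
have gE x y : g (x, y) = psi (f x, y) by rewrite rcompE rsum_morE id_lfunE.
have g'E x y : g' (x, y) = (x, f' y) by rewrite rsum_morE id_lfunE.
apply/memv_imgP/memv_imgP => -[[x y] _ ->].
  rewrite gE; case E : (psi (f x, y)) => [u v].
  have [|w wE] := pi' v; first by have := psiE (f x, y); rewrite E /= rcompE pi0.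
  have [y' y'E] := (surjlP _).1 q'S w.
  by exists (u, y'); rewrite ?memvf // g'E rcompE -y'E -wE.
have [[u v] uvE] := (surjlP _).1 (riso_surj psi_iso) (x, f' y).
have [|w wE] := pi u.
  by have := psiE (u, v); rewrite -uvE /= rcompE pi'0.
have [x' x'E] := (surjlP _).1 qS w.
by exists (x', v); rewrite ?memvf // gE rcompE -x'E -wE g'E uvE.
Qed.

(** L (x)_A B is projective, so the tensored sequence splits, and (RM1) applies. *)
Lemma modrank_tens_additive (B : bimod A) :
  bprojective B -> additive_fn (fun C => n (tens C B)).
Proof.
move=> Bp M N L i p ip; apply: modrank_ses_proj (tens_ses Bp ip).
exact: tens_bprojective.
Qed.

(** The alternating sum over all the middle terms of C (x) theta: since d is odd, the last sign
    (-1)^d is -1. *)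
Let alpha C : R :=
  \sum_(j < d) (-1) ^+ j * n (tens C (bemid th j)) - n (tens C (bemid th d)).

Lemma alpha_additive : additive_fn alpha.
Proof.
move=> M N L i p ip; rewrite /alpha.
rewrite (modrank_tens_additive (bemid_bprojective thP (leqnn d)) ip).
rewrite (eq_bigr (fun j : 'I_d => (-1) ^+ j * n (tens M (bemid th j)) +
   (-1) ^+ j * n (tens L (bemid th j)))) ?big_split /=; first ring.
move=> j _.
by rewrite (modrank_tens_additive (bemid_bprojective thP (ltnW (ltn_ord j))) ip) mulrDr.
Qed.

(** K and K2 are a first and a second syzygy of C, namely the images of the last two arrows of its
    angle into Sigma X_0. *)
Lemma modrank_resolution C : exists K2 K (P P' : projmod A)
    (i : rhom K P) (p : rhom P C) (i' : rhom K2 P') (p' : rhom P' K),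
  [/\ ses i p /\ ses i' p', risom P (tens C (Defs.belast th)),
      n P' = n (tens C (bemid th d)), n K2 + n K = n (tens C (bemid th d))
    & n C = alpha C + n K].
Proof.
have [S [p [Sang [pS lp] fC Sob Slast]]] := tensor_angle thP d_gt0 C.
have [[_ ml _] _] := Sang.
have [rm rl] := rk_RM2 r Sang.
have [i' [p' s']] := fac_exact_ses (fac_rimg (smor S d)) (fac_rimg (slast S)) ml.
have [i [q s0]] := fac_exact_ses (fac_rimg (slast S)) (fac_surj pS) lp.
have r1 j : (j <= d)%N -> rk r (rid (sob S j.+1)) = n (tens C (bemid th j)).
  by move=> /Sob /modrank_iso <-; rewrite modrank_proj.
exists (rimg (smor S d)), (rimg (slast S)), (pshift s (sob S 0)), (sob S d.+1).
exists i, q, i', p'; split=> //.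
- by rewrite modrank_proj r1.
- by rewrite -!(nE (fac_rimg _)); move: rl; rewrite r1 // => rl; lra.
have x0E : rk r (smor S 0) = n C by rewrite -(rk_RM3 r (smor S 0)); apply: nE.
(* Telescoping (RM2) along the angle, starting from rk x_0 = n C, which holds by (RM3). *)
have E m : (m <= d)%N -> n C =
    \sum_(j < m) (-1) ^+ j * n (tens C (bemid th j)) + (-1) ^+ m * rk r (smor S m).
  elim: m => [|m IH] md; first by rewrite big_ord0 add0r mul1r x0E.
  rewrite {}IH ?(ltnW md) // big_ord_recr /= -addrA; congr (_ + _).
  have := rm m md; rewrite r1 ?(ltnW md) // exprS => e.
  have -> : rk r (smor S m) = n (tens C (bemid th m)) - rk r (smor S m.+1) by lra.
  ring.
rewrite (E d (leqnn d)) /alpha -signr_odd d_odd -(nE (fac_rimg _)).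
by move: rl; rewrite r1 // expr1 mulN1r => rl; lra.
Qed.

Lemma modrank_additive : additive_fn n.
Proof.
pose beta C := alpha C + n (tens C (Defs.belast th)).
have Bp := belast_bprojective thP.
have betaD : additive_fn beta.
  move=> M N L i p ip.
  by rewrite /beta (alpha_additive ip) (modrank_tens_additive Bp ip); ring.
(* With K the syzygy of D and K' that of K, Schanuel's lemma gives n (K (x) P_0) = n K + n K'.
   Together with n K = alpha K + n K' this yields 2 n K = beta K = beta (D (x) P_0) - beta D. *)
have nE' D : n D = alpha D + (beta (tens D (Defs.belast th)) - beta D) / 2.
  have [K2 [K [P [P' [i [p [i' [p' [[ip i'p'] PE P'E K2K ->]]]]]]]]] := modrank_resolution D.
  congr (_ + _).
  have [_ [K' [P1 [_ [j [q [_ [_ [[jq _] P1E _ _ KE]]]]]]]]] := modrank_resolution K.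
  have := modrank_schanuel i'p' jq; rewrite P'E (modrank_iso P1E).
  have := betaD _ _ _ _ _ ip; rewrite (additive_fn_iso betaD PE) => ->.
  rewrite addrK; rewrite /beta => e; lra.
move=> M N L i p ip; rewrite !nE' (alpha_additive ip) (betaD _ _ _ _ _ ip).
rewrite (betaD _ _ _ _ _ (tens_ses Bp ip)); lra.
Qed.

End RankToAdditive.

(** * Rank functions and shift-invariant additive functions *)

Section Correspondence.
Variables (k : fieldType) (A : falgType k) (d : nat) (s : algaut A).
Variable th : bext d (twist (aut_inv s)) (breg A).
Variable R : realType.

Lemma rank_additive (r : rankfn th R) : periodicity_seq th -> odd d ->
  exists phi : rmod A -> R,
    [/\ additive_fn phi, forall M, 0 <= phi M,
        forall M, phi (tens M (twist s)) = phi M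
      & forall (X Y : projmod A) (f : rhom X Y) M, fac f M -> r X Y f = phi M].
Proof.
move=> thP dO; have [n nE] := rk_image_fun thP dO r.
exists n; split=> // [|M|M].
- exact: modrank_additive nE.
- by have [X [Y [f /nE <-]]] := fac_exists thP dO M; apply: rk_ge0.
have [X [Y [f fM]]] := fac_exists thP dO M.
rewrite -(nE _ _ _ _ fM) -(rk_RM3 r f); apply/esym.
exact: (nE (pshift s X) (pshift s Y)) (shift_fac s fM).
Qed.

Lemma additive_rank (phi : rmod A -> R) :
  additive_fn phi -> (forall M, 0 <= phi M) ->
  (forall M, phi (tens M (twist s)) = phi M) ->
  exists r : rankfn th R,
    forall (X Y : projmod A) (f : rhom X Y) M, fac f M -> r X Y f = phi M.
Proof.
move=> phiD phi_ge0 phiS; pose rk (X Y : projmod A) (f : rhom X Y) := phi (rimg f).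
have rkE (X Y : projmod A) (f : rhom X Y) M : fac f M -> rk X Y f = phi M.
  by move=> fM; apply: additive_fn_iso phiD (fac_risom (fac_rimg f) fM).
have rk0 (X Y : projmod A) (f : rhom X Y) : 0 <= rk X Y f by apply: phi_ge0.
have RM0 (X Y X' Y' : projmod A) (f : rhom X Y) (g : rhom X' Y')
      (psi : rhom X X') (ph : rhom Y Y') :
    is_riso psi -> is_riso ph -> (ph \o f = g \o psi)%VF -> rk X Y f = rk X' Y' g.
  move=> psi_iso ph_iso e; apply/esym/rkE.
  have [p [i [pS iI fE]]] := fac_rimg f.
  have [inv [invK Kinv]] := (is_risoP psi).1 psi_iso.
  exists (rcomp p inv), (rcomp ph i); split.
  - apply/surjlP => y; have [x ->] := (surjlP _).1 pS y.
    by exists (psi x); rewrite rcompE invK.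
  - apply/injlP => x; rewrite rcompE => /((injlP _).1 (riso_inj ph_iso)).
    exact: ((injlP _).1 iI).
  move=> x; rewrite -{1}(Kinv x) -(comp_lfunE g) -e comp_lfunE fE.
  by rewrite !rcompE.
have RM1 (X Y X' Y' : projmod A) (f : rhom X Y) (g : rhom X' Y') :
    rk (psum X X') (psum Y Y') (rsum_mor f g) = rk X Y f + rk X' Y' g.
  rewrite (rkE (psum X X') (psum Y Y') _ _ (fac_sum (fac_rimg f) (fac_rimg g))).
  exact: phiD (ses_sum _ _).
(* Exactness at Y gives 0 -> im f -> Y -> im g -> 0, and (RM2) is additivity along this sequence. *)
have RM2 (X Y Z : projmod A) (f : rhom X Y) (g : rhom Y Z) :
    exact_at f g -> rk X Y f - rk Y Y (rid Y) + rk Y Z g = 0.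
  move=> fg; have [i [p ip]] := fac_exact_ses (fac_rimg f) (fac_rimg g) fg.
  rewrite (rkE Y Y (rid Y) Y) ?(phiD _ _ _ _ _ ip); last exact/fac_surj/riso_surj/riso_id.
  by rewrite opprD addrA subrr add0r addNr.
have RM3 (X Y : projmod A) (f : rhom X Y) :
    rk (pshift s X) (pshift s Y) (shift_mor s f) = rk X Y f.
  by rewrite (rkE (pshift s X) (pshift s Y) _ _ (shift_fac s (fac_rimg f))) phiS.
have RM2' (S : dseq d s) : angle th S ->
    (forall i, (i < d)%N ->
       rk _ _ (smor S i) - rk _ _ (rid (sob S i.+1)) + rk _ _ (smor S i.+1) = 0) /\
    rk _ _ (smor S d) - rk _ _ (rid (sob S d.+1)) + rk _ (pshift s (sob S 0)) (slast S) = 0.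
  by move=> [[ei el _] _]; split=> [i /ei|]; apply: RM2.
by exists (RankFn rk0 RM0 RM1 RM2' RM3).
Qed.

End Correspondence.

(** * Simple modules and primitive idempotents *)

Section Simples.
Variables (k : fieldType) (A : falgType k).
Implicit Types (M N L S : rmod A) (a b e z : A).

Lemma ractMx M a b x : ract M (a * b) x = ract M b (ract M a x).
Proof. by rewrite ractM comp_lfunE. Qed.

Definition simple_rmod M :=
  (exists x : M, x != 0) /\ forall U : {vspace M}, stable U -> U = 0%VS \/ U = fullv.

(** This replaces composition series: a proper nonzero submodule and its quotient both have smaller
    dimension. *)
Lemma rmod_ind (Q : rmod A -> Prop) :
  (forall M, (forall x : M, x = 0) -> Q M) -> (forall M, simple_rmod M -> Q M) ->
  (forall M N L (i : rhom M N) (p : rhom N L), ses i p -> Q M -> Q L -> Q N) ->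
  forall M, Q M.
Proof.
move=> Q0 Qs Qe M; have [n] := ubnP (\dim {:M}); elim: n M => // n IH M dM.
have [M0|/existsNP[x /eqP x0]] := pselect (forall x : M, x = 0); first exact: Q0.
have [sM|nsM] := pselect (forall U : {vspace M}, stable U -> U = 0%VS \/ U = fullv).
  by apply: Qs; split=> //; exists x.
move: nsM => /existsNP[U /not_implyP[sU /not_orP[U0 UT]]].
have dU : (0 < \dim U)%N by rewrite lt0n dimv_eq0; apply/eqP.
have dU' : (\dim U < \dim {:M})%N.
  by rewrite ltnNge; apply/negP => le; apply: UT; apply/eqP; rewrite eqEdim subvf.
have := dim_rquo sU => dQ.
apply: (Qe _ _ _ _ _ (ses_sub sU)); apply: IH; first by rewrite dim_rsub; lia.
by lia.
Qed.

Lemma riso_schur S M (f : rhom S M) x :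
  simple_rmod S -> simple_rmod M -> f x != 0 -> is_riso f.
Proof.
move=> [_ Ss] [_ Ms] fx0; apply: bij_riso.
  have [K0|KT] := Ss _ (lker_stable f); first exact/eqP.
  by have := memvf x; rewrite -KT memv_ker (negPf fx0).
have [I0|IT] := Ms _ (limg_stable f); last exact/eqP.
by have := memv_img f (memvf x); rewrite I0 memv0 (negPf fx0).
Qed.

Definition orbit_map M (x : M) : 'Hom(A, M) := linfun (fun a => ract M a x).

Lemma orbit_mapE M (x : M) a : orbit_map x a = ract M a x.
Proof.
by rewrite /orbit_map linfunE // => c u v; rewrite linearP add_lfunE scale_lfunE.
Qed.

Lemma simple_gen M (x y : M) : simple_rmod M -> x != 0 -> exists a, y = ract M a x.
Proof.
move=> [_ Ms] x0; have [|U0|UT] := Ms (limg (orbit_map x)).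
- move=> a _ /memv_imgP[b _ ->]; apply/memv_imgP; exists (b * a); rewrite ?memvf //.
  by rewrite !orbit_mapE ractMx.
- have : x \in limg (orbit_map x).
    by apply/memv_imgP; exists 1; rewrite ?memvf // orbit_mapE ract1 id_lfunE.
  by rewrite U0 memv0 (negPf x0).
have := memvf y; rewrite -UT => /memv_imgP[a _ ->].
by exists a; rewrite orbit_mapE.
Qed.

(** Fitting's lemma for left multiplication by z on e A *)
Lemma primitive_fitting e z : primitive_idem e -> e * z = z -> z * e = z ->
  (exists n, z ^+ n = 0) \/ exists w, z * w = e.
Proof.
move=> [ee _ eprim] ez ze.
pose U n := limg (amull (z ^+ n)).
have UE n x : (x \in U n) <-> exists y, x = z ^+ n * y.
  split=> [/memv_imgP[y _ ->]|[y ->]]; first by exists y; rewrite lfunE.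
  by apply/memv_imgP; exists y; rewrite ?memvf // lfunE.
have US m n : (m <= n)%N -> (U n <= U m)%VS.
  move=> /subnKC <-; apply/subvP => x /UE[y ->]; apply/UE.
  by exists (z ^+ (n - m) * y); rewrite exprD mulrA.
(* The images of the powers of z stabilise. Comparing the exponents n + 1 and 2 (n + 1) makes q =
   z^(n+1) act surjectively, hence injectively, on its own image. *)
have [n Un] : exists n, U n.+1 = U (n.+1 + n.+1)%N.
  have ex : exists m, `[< exists n, \dim (U n) = m >].
    by exists (\dim (U 0)); apply/asboolP; exists 0.
  case: (ex_minnP ex) => m /asboolP[n nm] mmin; exists n; apply/esym/eqP.
  rewrite eqEdim US ?leq_addr //=; apply: leq_trans (dimvS (US n n.+1 _)) _ => //.
  by rewrite nm mmin //; apply/asboolP; exists (n.+1 + n.+1)%N.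
set q := z ^+ n.+1.
have eq : e * q = q by rewrite /q exprS mulrA ez.
have qe : q * e = q by rewrite /q exprSr -mulrA ze.
have [w wE] : exists w, q = q * (q * w).
  have : q \in U (n.+1 + n.+1)%N by rewrite -Un; apply/UE; exists 1; rewrite mulr1.
  by move/UE => [w]; rewrite exprD -mulrA => wE; exists w.
have inj x : q * (q * x) = 0 -> q * x = 0.
  move=> qqx; pose f := amull q; have fE y : f y = q * y by rewrite lfunE.
  have := limg_ker_dim f (U n.+1).
  have -> : (f @: U n.+1)%VS = U n.+1.
    rewrite {2}Un; apply/vspaceP => y.
    apply/idP/idP => [/memv_imgP[_ /UE[u ->] ->]|/UE[u ->]].
      by apply/UE; exists u; rewrite fE exprD -mulrA.
    apply/memv_imgP; exists (q * u); last by rewrite fE exprD -mulrA.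
    by apply/UE; exists u.
  move/(canRL (addnK _)); rewrite subnn => /eqP; rewrite dimv_eq0 => /eqP K0.
  apply/eqP; rewrite -memv0 -K0 memv_cap memv_ker fE qqx eqxx andbT.
  by apply/UE; exists x.
(* [f] projects e A onto q A, and q kills [e - f]; primitivity makes one of the two zero. If f = 0
   then q = q f = 0, and if f = e then e = z (z^n w e). *)
pose f := q * w * e.
have qf : q * f = q by rewrite /f !mulrA -(mulrA q q w) -wE qe.
have ef : e * f = f by rewrite /f !mulrA eq.
have fe : f * e = f by rewrite /f -!mulrA ee.
have ff : f * f = f.
  have E : q * (q * (w * e)) = q by rewrite (mulrA q w e) mulrA -wE qe.
  have : q * (w * e - w * e * f) = 0.
    apply: inj; rewrite mulrBr mulrBr E (mulrA q (w * e)) (mulrA q (q * (w * e))).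
    by rewrite E qf subrr.
  by rewrite mulrBr !mulrA -/f => /eqP; rewrite subr_eq0 => /eqP.
have [||||f0|/eqP] := eprim f (e - f) ff.
- by rewrite mulrBr !mulrBl ee fe ef ff subrr subr0.
- by rewrite mulrBr fe ff subrr.
- by rewrite mulrBl ef ff subrr.
- by rewrite addrC subrK.
- by left; exists n.+1; rewrite -/q -qf f0 mulr0.
rewrite subr_eq0 => /eqP ->; right; exists (z ^+ n * w * e).
by rewrite /f /q exprS !mulrA.
Qed.

Lemma idem_not_nilp M (x : M) e z : primitive_idem e -> e * z = z -> z * e = z ->
  x != 0 -> ract M z x = x -> exists w, z * w = e.
Proof.
move=> ep ez ze x0 xz; have [[n zn]|//] := primitive_fitting ep ez ze.
have xn m : ract M (z ^+ m) x = x.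
  by elim: m => [|m IH]; rewrite ?ract1 ?id_lfunE // exprS ractMx xz.
by move: (xn n); rewrite zn linear0 zero_lfunE => x00; rewrite -x00 eqxx in x0.
Qed.

(** x0 and y0 generate M and S, and x0 a |-> y0 a is the isomorphism; it is well defined by the
    inclusion [ann] of annihilators. *)
Lemma simple_unique e M S (x : M) (y : S) : primitive_idem e ->
  simple_rmod M -> simple_rmod S -> ract M e x != 0 -> ract S e y != 0 -> risom M S.
Proof.
move=> ep Ms Ss; have [ee _ _] := ep.
set x0 := ract M e x => x00; set y0 := ract S e y => y00.
have x0e : ract M e x0 = x0 by rewrite -ractMx ee.
have y0e : ract S e y0 = y0 by rewrite -ractMx ee.
(* If x0 a = 0 but y0 a b = y0, then z = e a b e kills x0 and fixes y0, so that z
   is neither invertible in e A e nor nilpotent. *)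
have ann a : ract M a x0 = 0 -> ract S a y0 = 0.
  move=> xa; apply/eqP; apply: contraNT x00 => ya.
  have [b bE] := simple_gen y0 Ss ya.
  have [||||w wE] := @idem_not_nilp S y0 e (e * (a * b) * e) ep.
  - by rewrite !mulrA ee.
  - by rewrite -!mulrA ee.
  - exact: y00.
  - by rewrite !ractMx y0e -bE.
  by rewrite -x0e -wE !ractMx x0e xa !linear0.
pose f := (orbit_map y0 \o (orbit_map x0)^-1)%VF.
have fE a : f (ract M a x0) = ract S a y0.
  apply/eqP; rewrite -subr_eq0 comp_lfunE -!orbit_mapE -linearB /=; apply/eqP.
  rewrite [LHS]orbit_mapE; apply: ann.
  rewrite -[LHS]orbit_mapE linearB /= limg_lfunVK ?subrr //.
  exact/memv_img/memvf.
have fA a u : f (ract M a u) = ract S a (f u).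
  by have [b ->] := simple_gen u Ms x00; rewrite -ractMx !fE ractMx.
exists (RHom fA); apply: (riso_schur (x := x0) Ms Ss).
by have := fE 1; rewrite !ract1 !id_lfunE /= => ->.
Qed.

Lemma mem_ideal e a : e * e = e -> (a \in limg (amull e)) = (e * a == a).
Proof.
move=> ee; apply/memv_imgP/eqP => [[b _ ->]|ea]; first by rewrite lfunE /= mulrA ee.
by exists a; rewrite ?memvf // lfunE.
Qed.

Lemma rideal_mul_surj e e' x w : e * e = e -> e' * e' = e' -> e * x = x ->
  x * w = e -> w = e' * w ->
  exists f : rhom (rideal e') (rideal e), surjl f.
Proof.
move=> ee e'e' ex xw we'.
pose f (u : rideal e') : rideal e := vsproj (limg (amull e)) (x * vsval u).
have fE u : vsval (f u) = x * vsval u.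
  by rewrite /f vsprojK // mem_ideal // mulrA ex.
have fL : linear f.
  by move=> c u v; apply: val_inj; rewrite [LHS]fE !linearP /= !fE mulrDr -scalerAr.
have fA a u : f (ract (rideal e') a u) = ract (rideal e) a (f u).
  by apply: val_inj; rewrite /= fE !rideal_actE fE mulrA.
exists (rhom_of fL fA); apply/surjlP => v.
have vE : e * vsval v = vsval v by apply/eqP; rewrite -mem_ideal // subvsP.
exists (vsproj (limg (amull e')) (w * vsval v)); apply: val_inj.
rewrite rhom_ofE /= fE vsprojK; last by rewrite mem_ideal // mulrA -we'.
by rewrite mulrA xw vE.
Qed.

(** [u] in e A e' and [v] in e' A e carry x0 to y0 and back. So u v and v u fix nonzero vectors, and
    Fitting's lemma gives u v w = e and v u w' = e'. Left multiplications by u and v are then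
    surjections between e' A and e A in both directions, and dimensions force an isomorphism. *)
Lemma simple_ideal_iso e e' S (x x' : S) : primitive_idem e -> primitive_idem e' ->
  simple_rmod S -> ract S e x != 0 -> ract S e' x' != 0 ->
  risom (rideal e) (rideal e').
Proof.
move=> ep ep' Ss; have [ee _ _] := ep; have [e'e' _ _] := ep'.
set x0 := ract S e x => x00; set y0 := ract S e' x' => y00.
have x0e : ract S e x0 = x0 by rewrite -ractMx ee.
have y0e : ract S e' y0 = y0 by rewrite -ractMx e'e'.
have [a aE] := simple_gen y0 Ss x00.
have [b bE] := simple_gen x0 Ss y00.
pose u := e * a * e'; pose v := e' * b * e.
have ux : ract S u x0 = y0 by rewrite !ractMx x0e -aE.
have vy : ract S v y0 = x0 by rewrite !ractMx y0e -bE.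
have eu : e * u = u by rewrite /u !mulrA ee.
have ue : u * e' = u by rewrite /u -!mulrA e'e'.
have ev : e' * v = v by rewrite /v !mulrA e'e'.
have ve : v * e = v by rewrite /v -!mulrA ee.
have [||||w wE] := @idem_not_nilp S x0 e (u * v) ep.
- by rewrite mulrA eu.
- by rewrite -mulrA ve.
- exact: x00.
- by rewrite ractMx ux vy.
have [||||w' w'E] := @idem_not_nilp S y0 e' (v * u) ep'.
- by rewrite mulrA ev.
- by rewrite -mulrA ue.
- exact: y00.
- by rewrite ractMx vy ux.
have [f fS] : exists f : rhom (rideal e') (rideal e), surjl f.
  by apply: (@rideal_mul_surj e e' u (v * w)) => //; rewrite mulrA ?ev.
have [g gS] : exists g : rhom (rideal e) (rideal e'), surjl g.
  by apply: (@rideal_mul_surj e' e v (u * w')) => //; rewrite mulrA ?eu.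
exists g; apply: bij_riso => //.
have := limg_ker_dim f fullv; have := limg_ker_dim g fullv.
rewrite (eqP fS) (eqP gS) !capfv /injl -dimv_eq0; lia.
Qed.

(** For an idempotent e this is the dimension of Hom_A(e A, M), an exact functor of M. *)
Definition idim e M := \dim (limg (ract M e)).

Lemma idim_ses e M N L (i : rhom M N) (p : rhom N L) :
  e * e = e -> ses i p -> idim e N = (idim e M + idim e L)%N.
Proof.
move=> ee [iI /exact_atP[pi0 pi] pS].
have eN y : y \in limg (ract N e) -> ract N e y = y.
  by move=> /memv_imgP[u _ ->]; rewrite -ractMx ee.
rewrite /idim -(limg_ker_dim p (limg (ract N e))); congr (_ + _)%N; last first.
  congr (\dim _); apply/vspaceP => y; apply/memv_imgP/memv_imgP.
    move=> [_ /memv_imgP[u _ ->] ->]; exists (p u); rewrite ?memvf //.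
    by rewrite rhomP.
  move=> [u _ ->]; have [x ->] := (surjlP _).1 pS u.
  exists (ract N e x); last by rewrite rhomP.
  exact/memv_img/memvf.
rewrite -(limg_dim_eq (f := i)); last first.
  by apply/eqP; rewrite -subv0 -(eqP iI) capvSr.
congr (\dim _); apply/vspaceP => y; rewrite memv_cap memv_ker.
apply/andP/memv_imgP => [[yU /eqP/pi[x xE]]|[_ /memv_imgP[u _ ->] ->]].
  exists (ract M e x); first exact/memv_img/memvf.
  by rewrite rhomP -xE eN.
by split; [rewrite rhomP memv_img ?memvf|rewrite pi0].
Qed.

Lemma idim_gt0 e M : (0 < idim e M)%N <-> exists x, ract M e x != 0.
Proof.
rewrite lt0n dimv_eq0; split=> [nz|[x]]; last first.
  by apply: contraNneq => I0; rewrite -memv0 -I0 memv_img ?memvf.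
apply: contrapT => /forallNP all0; case/negP: nz; rewrite -subv0.
apply/subvP => _ /memv_imgP[x _ ->]; rewrite memv0.
by apply/negPn/negP/all0.
Qed.

Lemma idim_iso e M N : risom M N -> idim e M = idim e N.
Proof.
move=> [f fi]; have fI := riso_inj fi.
rewrite /idim -(limg_dim_eq (f := f)); last first.
  by apply/eqP; rewrite -subv0 -(eqP fI) capvSr.
congr (\dim _); apply/vspaceP => y; apply/memv_imgP/memv_imgP.
  move=> [_ /memv_imgP[u _ ->] ->]; exists (f u); rewrite ?memvf //.
  by rewrite rhomP.
move=> [u _ ->]; have [x ->] := (surjlP _).1 (riso_surj fi) u.
exists (ract M e x); last by rewrite rhomP.
exact/memv_img/memvf.
Qed.

(** S_i is the one simple module that e_i does not annihilate. It is found by dévissage of A, is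
    unique by [simple_unique], and determines i because the ideals e_i A are pairwise
    non-isomorphic. *)
Lemma basic_simples : basic_algebra A ->
  exists (n : nat) (S : 'I_n -> rmod A) (m : 'I_n -> rmod A -> nat),
    [/\ forall i, simple_rmod (S i),
        forall M, simple_rmod M -> exists i, risom M (S i),
        forall i M N L (f : rhom M N) (p : rhom N L),
          ses f p -> m i N = (m i M + m i L)%N
      & forall i j, m i (S j) = (i == j)].
Proof.
move=> [n [e [ep eo e1 eb]]].
have ee i : e i * e i = e i by case: (ep i).
have /choice[S SP] : forall i, exists S, simple_rmod S /\ (0 < idim (e i) S)%N.
  move=> i; have : (0 < idim (e i) (rreg A))%N.
    apply/idim_gt0; exists (1 : A); rewrite rreg_ractE mul1r.
    by case: (ep i).
  move: (rreg A); apply: rmod_ind => [M M0|M Ms Mi|M N L f p fp IM IL].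
  - by move=> /idim_gt0[x]; rewrite (M0 x) linear0 eqxx.
  - by exists M.
  by rewrite (idim_ses (ee i) fp) addn_gt0 => /orP[/IM|/IL].
have Suniq i M : simple_rmod M -> (0 < idim (e i) M)%N -> risom M (S i).
  move=> Ms /idim_gt0[x x0]; have [Ss /idim_gt0[y y0]] := SP i.
  exact: simple_unique (ep i) Ms Ss x0 y0.
have S0 i j : i != j -> idim (e i) (S j) = 0%N.
  move=> ij; apply/eqP; rewrite -leqn0 leqNgt; apply/negP => /idim_gt0[x x0].
  have [Ss /idim_gt0[y y0]] := SP j.
  by rewrite (eb i j (simple_ideal_iso (ep i) (ep j) Ss x0 y0)) eqxx in ij.
have Sex M : simple_rmod M -> exists i, risom M (S i).
  move=> Ms; have [[x x0] _] := Ms.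
  suff [i xi] : exists i, ract M (e i) x != 0.
    by exists i; apply: Suniq => //; apply/idim_gt0; exists x.
  apply: contrapT => /forallNP all0; case/negP: x0.
  rewrite -(id_lfunE x) -ract1 -e1 linear_sum sum_lfunE big1 // => i _.
  by apply/eqP/negPn/negP/all0.
(* dim M e_i counts each factor S_i with weight dim S_i e_i, which may exceed 1 over a general
   field; the division is exact by [dvd]. *)
exists n, S, (fun i M => (idim (e i) M %/ idim (e i) (S i))%N).
have dvd i M : (idim (e i) (S i) %| idim (e i) M)%N.
  move: M; apply: rmod_ind => [M M0|M Ms|M N L f p fp IM IL].
  - suff -> : idim (e i) M = 0%N by [].
    apply/eqP; rewrite -leqn0 leqNgt; apply/negP => /idim_gt0[x].
    by rewrite (M0 x) linear0 eqxx.
  - have [j /idim_iso ->] := Sex M Ms.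
    by have [->|/S0 ->] := eqVneq i j.
  by rewrite (idim_ses (ee i) fp) dvdn_add.
split=> // [i|i M N L f p fp|i j].
- by case: (SP i).
- by rewrite (idim_ses (ee i) fp) divnDl.
have [<-|/S0 ->] := eqVneq i j; last by rewrite div0n.
by rewrite divnn; case: (SP i) => _ ->.
Qed.

End Simples.

(** * Rank functions as invariant weights on the simple modules *)

Section Weights.
Variables (k : fieldType) (A : falgType k) (d : nat) (s : algaut A).
Variable th : bext d (twist (aut_inv s)) (breg A).
Variable R : realType.

Lemma risom_sym (M N : rmod A) : risom M N -> risom N M.
Proof.
move=> [f /is_risoP[g [fK gK]]].
by exists g; apply/is_risoP; exists f.
Qed.

Lemma risom_trans (M N L : rmod A) : risom M N -> risom N L -> risom M L.
Proof. by move=> [f fi] [g gi]; exists (rcomp g f); apply: riso_comp. Qed.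

Lemma shift_simple (t : algaut A) (M : rmod A) :
  simple_rmod M -> simple_rmod (tens M (twist t)).
Proof.
have tI := (injlP _).1 (tone_inj t M); have tS := (surjlP _).1 (tone_surj t M).
move=> [[x x0] Ms]; split.
  by exists (tone t M x); apply: contraNneq x0 => /tI /eqP.
move=> U sU; have [|U0|UT] := Ms (tone t M @^-1: U)%VS.
- by move=> a y; rewrite -!memv_preim tone_ract; apply: sU.
- left; apply/eqP; rewrite -subv0; apply/subvP => z.
  by have [y ->] := tS z; rewrite memv_preim U0 !memv0 => /eqP ->; rewrite linear0.
- right; apply/eqP; rewrite eqEsubv subvf; apply/subvP => z _.
  by have [y ->] := tS z; rewrite memv_preim UT memvf.
Qed.

Lemma additive_fn_decomp n (S : 'I_n -> rmod A) (m : 'I_n -> rmod A -> nat)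
    (phi : rmod A -> R) :
  (forall M, simple_rmod M -> exists i, risom M (S i)) ->
  (forall i, additive_fn (fun M => (m i M)%:R : R)) ->
  (forall i j, m i (S j) = (i == j)) -> additive_fn phi ->
  forall M, phi M = \sum_i phi (S i) * (m i M)%:R.
Proof.
move=> Sex mD mS phiD; apply: rmod_ind => [M M0|M /Sex[j Mj]|M N L f p fp IM IL].
- rewrite (additive_fn0 phiD M0) big1 // => i _.
  by rewrite [_%:R](additive_fn0 (mD i) M0) mulr0.
- rewrite (additive_fn_iso phiD Mj) (bigD1 j) //= big1 ?addr0 => [|i ij].
    by rewrite [_%:R](additive_fn_iso (mD j) Mj) mS eqxx mulr1.
  by rewrite [_%:R](additive_fn_iso (mD i) Mj) mS (negPf ij) mulr0.
rewrite (phiD _ _ _ _ _ fp) IM IL -big_split; apply: eq_bigr => i _ /=.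
by rewrite [(m i N)%:R](mD i _ _ _ _ _ fp) mulrDr.
Qed.

(** Angles leave the argument here. [pi] is the action of Sigma_d on simple modules and [mu i] the
    multiplicity of S_i in the image; the last clause supplies test morphisms, with image S_i, that
    isolate one weight. *)
Lemma rank_weights : basic_algebra A -> periodicity_seq th -> odd d ->
  exists n (pi : 'I_n -> 'I_n) (mu : 'I_n -> forall X Y : projmod A, rhom X Y -> nat),
  [/\ injective pi,
      forall r : rankfn th R, exists c : 'I_n -> R,
        [/\ forall i, 0 <= c i, forall i, c (pi i) = c i
          & forall X Y f, r X Y f = \sum_i c i * (mu i X Y f)%:R],
      forall c : 'I_n -> R, (forall i, 0 <= c i) -> (forall i, c (pi i) = c i) ->
        exists r : rankfn th R, forall X Y f, r X Y f = \sum_i c i * (mu i X Y f)%:R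
    & forall i, exists (X Y : projmod A) (f : rhom X Y),
        forall j, mu j X Y f = (j == i)].
Proof.
move=> /basic_simples[n [S [m [Ss Sex mD mS]]]] thP dO.
have mR i : additive_fn (fun M => (m i M)%:R : R).
  by move=> M N L f p fp; rewrite (mD i _ _ _ _ _ fp) natrD.
have m_iso i M N : risom M N -> m i M = m i N.
  by move=> /(additive_fn_iso (mR i))/eqP; rewrite eqr_nat => /eqP.
have /choice[pi piS] : forall i, exists j, risom (tens (S i) (twist s)) (S j).
  by move=> i; apply/Sex/shift_simple.
have pi_inj : injective pi.
  move=> i j ij; have /shift_riso_reflect/(m_iso i) : risom (tens (S i) (twist s))
      (tens (S j) (twist s)).
    by apply: risom_trans (piS i) _; rewrite ij; apply/risom_sym.
  by rewrite !mS eqxx; have [|] := eqVneq i j.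
(* The left side is additive in M, so it is enough to know it on S_j, where it is the multiplicity
   of S_(pi i) in S_(pi j). *)
have m_shift i M : (m (pi i) (tens M (twist s)))%:R = (m i M)%:R :> R.
  pose phi M := (m (pi i) (tens M (twist s)))%:R : R.
  have phiD : additive_fn phi by move=> M' N L f p /(shift_ses s)/(mR (pi i)).
  rewrite -/(phi M) (additive_fn_decomp Sex mR mS phiD) (bigD1 i) //= big1.
    by rewrite addr0 /phi (m_iso _ _ _ (piS i)) mS eqxx mul1r.
  move=> j ji; rewrite /phi (m_iso _ _ _ (piS j)) mS (inj_eq pi_inj) eq_sym.
  by rewrite (negPf ji) mul0r.
exists n, pi, (fun i X Y f => m i (rimg f)); split=> //.
- move=> r; have [phi [phiD phi0 phiS phiE]] := rank_additive r thP dO.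
  exists (fun i => phi (S i)); split=> // [i|X Y f].
    by rewrite -(additive_fn_iso phiD (piS i)) phiS.
  by rewrite (phiE _ _ _ _ (fac_rimg f)); apply: additive_fn_decomp.
- move=> c c0 cpi; pose phi M := \sum_i c i * (m i M)%:R.
  have [||M|r rE] := @additive_rank _ _ _ _ th R phi.
  + move=> M N L f p fp; rewrite /phi -big_split; apply: eq_bigr => i _ /=.
    by rewrite [(m i N)%:R](mR i _ _ _ _ _ fp) mulrDr.
  + by move=> M; apply: sumr_ge0 => i _; rewrite mulr_ge0.
  + rewrite /phi (reindex_inj pi_inj); apply: eq_bigr => i _ /=.
    by rewrite cpi m_shift.
  by exists r => X Y f; rewrite (rE _ _ _ _ (fac_rimg f)).
move=> i; have [X [Y [f fS]]] := fac_exists thP dO (S i).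
by exists X, Y, f => j; rewrite (m_iso j _ _ (fac_risom (fac_rimg f) fS)) mS.
Qed.

End Weights.

(** * Counting and matching finite fibres *)

Section Fibres.
Local Open Scope fset_scope.

Lemma fsbig_indic (R : realType) (I : choiceType) (b : pred I) :
  finite_set [set i | b i] ->
  \sum_(i \in [set: I]) ((b i)%:R : R) = (#|` fset_set [set i | b i]|)%:R :> R.
Proof.
move=> bfin; rewrite (@fsbigTE _ _ _ _ (fset_set [set i | b i])); last first.
  by move=> i; rewrite in_fset_set // mem_setE unfold_in => /negPf ->.
rewrite (eq_big_seq (fun=> 1)); last first.
  by move=> i; rewrite in_fset_set // mem_setE unfold_in => ->.
by rewrite big_const_seq count_predT iter_addr_0.
Qed.

(** [h] sends the element at some position in the enumeration of its fibre to the element at the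
    same position in the other fibre over the same point. *)
Lemma bijection_of_fibres (T : eqType) (I J : choiceType) (t : I -> T) (u : J -> T) :
  (forall x, finite_set [set i | t i == x]) ->
  (forall x, finite_set [set j | u j == x]) ->
  (forall x, #|` fset_set [set i | t i == x]| = #|` fset_set [set j | u j == x]|) ->
  exists h : I -> J, bijective h /\ forall i, t i = u (h i).
Proof.
move=> tf uf tu.
pose a x : seq I := fset_set [set i | t i == x].
pose b x : seq J := fset_set [set j | u j == x].
have inA x i : (i \in a x) = (t i == x) by rewrite in_fset_set // mem_setE.
have inB x j : (j \in b x) = (u j == x) by rewrite in_fset_set // mem_setE.
(* [nth] needs default values in I and in J, so empty index types are treated separately. *)
have [[j0]|noJ] := pselect (inhabited J); last first.
  have noI (i : I) : False.
    have : i \in a (t i) by rewrite inA.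
    have : size (b (t i)) = 0%N.
      by case E : (b (t i)) => [//|j l]; case: noJ; exists; exact: j.
    by rewrite -[size _]tu => /size0nil a0; rewrite /a a0.
  exists (fun i => False_rect J (noI i)); split=> [|i]; last by case: (noI i).
  by exists (fun j => False_rect I (noJ (inhabits j))) => i;
    [case: (noI i)|case: (noJ (inhabits i))].
have [[i0]|noI] := pselect (inhabited I); last first.
  have : j0 \in b (u j0) by rewrite inB.
  have : size (a (u j0)) = 0%N.
    by case E : (a (u j0)) => [//|i l]; case: noI; exists; exact: i.
  by rewrite [size _]tu => /size0nil b0; rewrite /b b0.
pose h i := nth j0 (b (t i)) (index i (a (t i))).
pose g j := nth i0 (a (u j)) (index j (b (u j))).
have hb i : h i \in b (t i).
  by rewrite mem_nth // -[size _]tu index_mem inA.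
have ga j : g j \in a (u j).
  by rewrite mem_nth // [size _]tu index_mem inB.
have uh i : u (h i) = t i by apply/eqP; rewrite -inB.
have tg j : t (g j) = u j by apply/eqP; rewrite -inA.
exists h; split=> //; exists g => x.
  by rewrite /g uh /h index_uniq ?fset_uniq ?nth_index ?inA // -[size _]tu index_mem inA.
by rewrite /h tg /g index_uniq ?fset_uniq ?nth_index ?inB // [size _]tu index_mem inB.
Qed.

End Fibres.

(** * Representatives of the orbits of a permutation *)

Section OrbitWeights.
Variables (n : nat) (pi : 'I_n -> 'I_n).
Hypothesis pi_inj : injective pi.

(** Injectivity makes reachability under [pi] symmetric, so [froot] picks one representative in each
    orbit. *)
Lemma froot_step i : froot pi (pi i) = froot pi i.
Proof. by apply/esym/eqP; rewrite (root_connect (fconnect_sym pi_inj)) fconnect1. Qed.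

Lemma invariant_froot T (c : 'I_n -> T) i :
  (forall j, c (pi j) = c j) -> c (froot pi i) = c i.
Proof.
move=> cpi; have /iter_findex <- := connect_root (frel pi) i.
by elim: (findex _ _ _) => //= m IH; rewrite cpi.
Qed.

End OrbitWeights.

Theorem theoremD (d : nat) (d_odd : odd d) (k : fieldType) (A : falgType k)
    (A_basic : basic_algebra A) (sigma : algaut A)
    (A_periodic : twisted_periodic d.+2 sigma)
    (theta : bext d (twist (aut_inv sigma)) (breg A))
    (thetaP : periodicity_seq theta)
    (R : realType) (rho : rankfn theta R) (rho_int : rk_integral rho) :
  (exists (I : choiceType) (ri : I -> rankfn theta R),
     (forall i, rk_irreducible (ri i)) /\ rk_lfsum ri rho) /\
  (forall (I J : choiceType) (ri : I -> rankfn theta R) (rj : J -> rankfn theta R),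
     (forall i, rk_irreducible (ri i)) -> rk_lfsum ri rho ->
     (forall j, rk_irreducible (rj j)) -> rk_lfsum rj rho ->
     exists h : I -> J, bijective h /\ forall i, rk_eq (ri i) (rj (h i))).
Proof.
have [n [pi [mu [pi_inj weight rank test]]]] := rank_weights R A_basic thetaP d_odd.
(* The indicator of the orbit represented by t. It is zero when t is not a chosen representative, so
   t may range over all indices. *)
pose w (t i : 'I_n) : R := (froot pi i == t)%:R.
have sum_test i (c : 'I_n -> R) (X Y : projmod A) (f : rhom X Y) :
    (forall j, mu j X Y f = (j == i)) -> \sum_j c j * (mu j X Y f)%:R = c i.
  move=> fi; rewrite (bigD1 i) //= big1 => [|j ji]; first by rewrite fi eqxx mulr1 addr0.
  by rewrite fi (negPf ji) mulr0.
have w_ge0 t i : 0 <= w t i by apply: ler0n.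
have w_pi t i : w t (pi i) = w t i by rewrite /w froot_step.
have froot2 i : froot pi (froot pi i) = froot pi i.
  exact/root_root/fconnect_sym.
have int_weight (r : rankfn theta R) (c : 'I_n -> R) :
    (forall X Y f, r X Y f = \sum_i c i * (mu i X Y f)%:R) ->
    rk_integral r -> forall i, c i \is a Num.int.
  move=> rE rint i; have [X [Y [f fi]]] := test i.
  by rewrite -(sum_test _ c _ _ _ fi) -rE.
have int_sum (r : rankfn theta R) (c : 'I_n -> R) :
    (forall X Y f, r X Y f = \sum_i c i * (mu i X Y f)%:R) ->
    (forall i, c i \is a Num.int) -> rk_integral r.
  by move=> rE cint X Y f; rewrite rE rpred_sum // => i _; rewrite rpredM ?natr_int.
have w_int t i : w t i \is a Num.int by apply: natr_int.
(* The natural numbers c1 t and c2 t add up to 1, so one of them vanishes, and by invariance it does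
   so on the whole orbit. Off the orbit both weights are squeezed to 0. *)
have chi_irr t (r : rankfn theta R) : froot pi t = t ->
    (forall X Y f, r X Y f = \sum_i w t i * (mu i X Y f)%:R) -> rk_irreducible r.
  move=> rt rE; split.
  - move=> r0; have [X [Y [f ft]]] := test t.
    have := r0 X Y f; rewrite rE (sum_test _ (w t) _ _ _ ft) /w rt eqxx.
    by apply/eqP/oner_neq0.
  - exact: int_sum rE (w_int t).
  move=> r1 r2 r1int r2int r12.
  have [c1 [c1_ge0 c1pi r1E]] := weight r1; have [c2 [c2_ge0 c2pi r2E]] := weight r2.
  have c12 i : w t i = c1 i + c2 i.
    have [X [Y [f fi]]] := test i.
    rewrite -(sum_test _ c1 _ _ _ fi) -(sum_test _ c2 _ _ _ fi).
    by rewrite -r1E -r2E -r12 rE (sum_test _ (w t) _ _ _ fi).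
  have zero (r' : rankfn theta R) (c : 'I_n -> R) : (forall i, 0 <= c i) ->
      (forall i, c (pi i) = c i) -> (forall i, c i <= w t i) -> c t = 0 ->
      (forall X Y f, r' X Y f = \sum_i c i * (mu i X Y f)%:R) -> rk_zero r'.
    move=> c_ge0 cpi cw ct0 r'E X Y f; rewrite r'E big1 // => i _.
    suff -> : c i = 0 by rewrite mul0r.
    have [it|it] := eqVneq (froot pi i) t; first by rewrite -(invariant_froot _ cpi) it.
    by apply/eqP; rewrite eq_le c_ge0 andbT (le_trans (cw i)) // /w (negPf it).
  have /natrP[a aE] : c1 t \is a Num.nat by rewrite natrEint c1_ge0 (int_weight _ _ r1E).
  have /natrP[b bE] : c2 t \is a Num.nat by rewrite natrEint c2_ge0 (int_weight _ _ r2E).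
  have : (a + b)%N = 1%N.
    by have := c12 t; rewrite /w rt eqxx aE bE -natrD => /eqP; rewrite eqr_nat => /eqP <-.
  case: a aE => [|a] aE ab.
    by left; apply: zero c1_ge0 c1pi _ aE r1E => i; rewrite c12 lerDl.
  right; apply: zero c2_ge0 c2pi _ _ r2E => [i|]; first by rewrite c12 lerDr.
  by rewrite bE; have -> : b = 0%N by lia.
(* A nonzero integral invariant weight is at least 1 on some whole orbit, so the indicator of that
   orbit splits off as a rank function; irreducibility leaves nothing else. *)
have irr_chi (r : rankfn theta R) : rk_irreducible r ->
    exists t, froot pi t = t /\ forall X Y f, r X Y f = \sum_i w t i * (mu i X Y f)%:R.
  move=> [r_neq0 r_int r_irr]; have [c [c_ge0 cpi rE]] := weight r.
  have [i ci0] : exists i, c i != 0.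
    apply: contrapT => /forallNP c0; apply: r_neq0 => X Y f.
    by rewrite rE big1 // => i _; have /negP/negPn/eqP -> := c0 i; rewrite mul0r.
  pose t := froot pi i; exists t; split; first exact: froot2.
  have wc j : w t j <= c j.
    rewrite /w; case: eqP => [jt|_]; last exact: c_ge0.
    rewrite -(invariant_froot _ cpi) jt (invariant_froot _ cpi).
    have /natrP[a aE] : c i \is a Num.nat by rewrite natrEint c_ge0 (int_weight _ _ rE).
    by rewrite aE ler_nat lt0n; apply: contraNneq ci0 => a0; rewrite aE a0.
  have [r1 r1E] := rank (fun j => c j - w t j)
    (fun j => eq_ind_r is_true (wc j) (subr_ge0 _ _))
    (fun j => congr2 (fun x y => x - y) (cpi j) (w_pi t j)).
  have [r2 r2E] := rank (w t) (w_ge0 t) (w_pi t).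
  have r12 (X Y : projmod A) (f : rhom X Y) : r X Y f = r1 X Y f + r2 X Y f.
    rewrite rE r1E r2E -big_split; apply: eq_bigr => j _ /=.
    by rewrite mulrBl subrK.
  have r1int : rk_integral r1.
    by apply: int_sum r1E _ => j; rewrite rpredB ?(int_weight _ _ rE).
  have [r10|r20] := r_irr r1 r2 r1int (int_sum _ _ r2E (w_int t)) r12.
    by move=> X Y f; rewrite r12 r10 add0r r2E.
  have [X [Y [f ft]]] := test t; have := r20 X Y f.
  rewrite r2E (sum_test _ (w t) _ _ _ ft) /w froot2 eqxx => /eqP.
  by rewrite oner_eq0.
have [c [c_ge0 cpi rhoE]] := weight rho; split.
  have /choice[N NE] : forall t, exists a : nat, c t = a%:R.
    by move=> t; apply/natrP; rewrite natrEint c_ge0 (int_weight _ _ rhoE).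
  have /choice[chi chiE] : forall t, exists r : rankfn theta R,
    forall X Y f, r X Y f = \sum_i w t i * (mu i X Y f)%:R.
    by move=> t; apply: rank.
  (* The indicator of an orbit enters as often as its weight says, and only for the chosen
     representative, so that no orbit is counted repeatedly. *)
  pose N' t := if froot pi t == t then N t else 0%N.
  exists {t : 'I_n & 'I_(N' t)}, (fun x => chi (tag x)); split=> [[t a]|X Y f].
    apply: chi_irr (chiE t) => /=.
    by move: a; rewrite /N'; case: eqP => // _ [].
  split; first exact: finite_finset.
  rewrite (@fsbigE _ _ _ _ _ (index_enum _)) ?index_enum_uniq //; last first.
    by move=> x _; rewrite mem_index_enum.
  rewrite (eq_bigl predT) => [|x]; last by rewrite in_setT.
  rewrite -(sig_big_dep predT (fun _ => predT) (fun t _ => chi t X Y f)) /=.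
  under [RHS]eq_bigr => t _ do rewrite sumr_const card_ord chiE -sumrMnl.
  rewrite exchange_big rhoE; apply: eq_bigr => i _ /=.
  rewrite (bigD1 (froot pi i)) //= big1 => [|t ti]; last first.
    by rewrite /w eq_sym (negPf ti) mul0r mul0rn.
  rewrite /w /N' froot2 !eqxx mul1r addr0 -(invariant_froot _ cpi) NE.
  by rewrite mulr_natl.
move=> I J ri rj ri_irr ri_sum rj_irr rj_sum.
have /choice[t tE] := fun i => irr_chi _ (ri_irr i).
have /choice[u uE] := fun j => irr_chi _ (rj_irr j).
(* The number of summands with label x is the same in every decomposition. If x represents an orbit,
   its test morphism gets 1 from each of them, 0 from the others, and c x in total; local finiteness
   at this morphism makes the fibre finite. Other x label no summand. *)
have fibre (K : choiceType) (rk : K -> rankfn theta R) (v : K -> 'I_n) :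
    (forall l, froot pi (v l) = v l /\
      forall X Y f, rk l X Y f = \sum_i w (v l) i * (mu i X Y f)%:R) ->
    rk_lfsum rk rho ->
    forall x, finite_set [set l | v l == x]%classic /\
      (#|` fset_set [set l | v l == x]%classic|)%:R = if froot pi x == x then c x else 0.
  move=> vE rk_sum x; case: eqP => [xroot|xnroot]; last first.
    have -> : [set l | v l == x]%classic = set0.
      by rewrite -subset0 => l /eqP vl; case: xnroot; rewrite -vl; case: (vE l).
    by split; [exact: finite_set0|rewrite fset_set0 cardfs0].
  have [X [Y [f fx]]] := test x; have [fin sum] := rk_sum X Y f.
  have rkE l : rk l X Y f = (v l == x)%:R.
    by rewrite (vE l).2 (sum_test _ (w (v l)) _ _ _ fx) /w xroot eq_sym.
  have E : [set l | rk l X Y f != 0]%classic = [set l | v l == x]%classic.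
    by apply/seteqP; split=> l /=; rewrite rkE pnatr_eq0; case: (v l == x).
  rewrite -E; split=> //; rewrite E -fsbig_indic -?E //.
  rewrite -(sum_test _ c _ _ _ fx) -rhoE sum.
  by apply: eq_fsbigr => l _; rewrite rkE.
have [||x|h [hbij th]] := @bijection_of_fibres _ I J t u.
- by move=> x; case: (fibre I ri t tE ri_sum x).
- by move=> x; case: (fibre J rj u uE rj_sum x).
- apply/eqP; rewrite -(eqr_nat R).
  by rewrite (fibre I ri t tE ri_sum x).2 (fibre J rj u uE rj_sum x).2.
by exists h; split=> // i X Y f; rewrite (tE i).2 (uE (h i)).2 th.
Qed.
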